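(* Let $X=SL(n+1)/P_k\cong Gr(k,n+1)$ with $k\le n+1-k$, and let $\lambda_1,\dots,\lambda_n$ be the fundamental dominant weights of $SL(n+1)$. For every integer $r\ge0$ the irreducible decomposition of $\mathrm{Sym}^rT_X$ is $$\mathrm{Sym}^rT_X=\bigoplus_{\substack{i_1+2i_2+\dots+ki_k=r\\ i_1,\dots,i_k\ge0}}E_{i_1(\lambda_1+\lambda_n)+i_2(\lambda_2+\lambda_{n-1})+\dots+i_k(\lambda_k+\lambda_{n-k+1})}.$$ Hence the fundamental highest weights of $T_X^*$ are $\lambda_j+\lambda_{n+1-j}$, of degree $j$, for $j=1,\dots,k$.
   Context: Everything is over $\mathbb{C}$. Simple roots $\alpha_i$ and fundamental weights $\lambda_i$ of $G=SL(n+1)$ are in Bourbaki order; $P_k$ is the maximal parabolic subgroup attached to $\alpha_k$, with the convention that its Lie algebra $\mathfrak p_k$ contains all negative root spaces, so that the weights of $\mathfrak g/\mathfrak p_k$ are the positive roots involving $\alpha_k$. Homogeneous vector bundles on $G/P_k$ are identified with $P_k$-modules, $T_X$ corresponding to $\mathfrak g/\mathfrak p_k$. $E_\lambda$ denotes the irreducible homogeneous vector bundle (irreducible $P_k$-module) with highest weight $\lambda$ with respect to the Levi part $R$ of $P_k$. Fundamental highest weights: for an $R$-module $V$ such that every irreducible $R$-module occurs at most once in the algebra of polynomials $\mathcal P(V)=\bigoplus_{i\ge0}\mathrm{Sym}^i(V^* )$, let $\Lambda$ be the set of highest weights occurring in $\mathcal P(V)$ and $h_\lambda$ the (unique up to scalar,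 homogeneous) highest weight vector of weight $\lambda\in\Lambda$. The fundamental highest weights of $V$ are the $\lambda\in\Lambda$ with $h_\lambda$ an irreducible polynomial; the degree of a fundamental highest weight $\omega$ is $\deg h_\omega$. Those of $T_X^*$ are the ones for $V=(\mathfrak g/\mathfrak p_k)^*$, so $\mathcal P(V)=\bigoplus_r\mathrm{Sym}^r(\mathfrak g/\mathfrak p_k)$. *)

(* Defs.v *)
From HB Require Import structures.
From mathcomp Require Import all_boot all_order all_algebra.
From mathcomp Require Import reals complex mpoly.

Set Implicit Arguments.
Unset Strict Implicit.
Unset Printing Implicit Defensive.

Import Order.TTheory GRing.Theory Num.Theory.

Local Open Scope ring_scope.

(** A representation on [W] of a group [H] of matrices is a map
    [rho : 'M_N -> W -> W] of which only the values on [H] matter.  Subspaces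
    are Prop-valued predicates, as [W] may be infinite-dimensional. *)
Section Representations.

Variables (F : fieldType) (N : nat) (W : lmodType F).
Variables (H : 'M[F]_N -> Prop) (rho : 'M[F]_N -> W -> W).
Implicit Types S : W -> Prop.

Definition subspace S : Prop :=
  S 0 /\ forall (a : F) u v, S u -> S v -> S (a *: u + v).

Definition submodule S : Prop :=
  subspace S /\ forall g v, H g -> S v -> S (rho g v).

Definition nonzero S : Prop := exists2 v, S v & v != 0.

Definition irreducible_module S : Prop :=
  [/\ submodule S, nonzero S &
      forall S', submodule S' -> (forall v, S' v -> S v) -> nonzero S' ->
        forall v, S v -> S' v].

Definition isomorphic_modules S1 S2 : Prop :=
  exists f : W -> W,
    [/\ forall v, S1 v -> S2 (f v),
        forall (a : F) u v, S1 u -> S1 v -> f (a *: u + v) = a *: f u + f v,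
        forall g v, H g -> S1 v -> f (rho g v) = rho g (f v),
        forall u v, S1 u -> S1 v -> f u = f v -> u = v &
        forall w, S2 w -> exists2 v, S1 v & f v = w].

Definition multiplicity_free : Prop :=
  forall S1 S2, irreducible_module S1 -> irreducible_module S2 ->
    isomorphic_modules S1 S2 -> forall v, S1 v <-> S2 v.

Definition direct_sum (I : finType) (P : pred I) (S_ : I -> W -> Prop) S :
    Prop :=
  [/\ forall i v, P i -> S_ i v -> S v,
      forall v, S v -> exists2 w : I -> W,
        (forall i, P i -> S_ i (w i)) & v = \sum_(i | P i) w i &
      forall w : I -> W, (forall i, P i -> S_ i (w i)) ->
        \sum_(i | P i) w i = 0 -> forall i, P i -> w i = 0].

End Representations.

(** The quotient [U / W] of subspaces of [vT] is realised on a complement of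
    [U :&: W] in [U]; [quot_pi] is the projection [U -> U / W]. *)
Section Quotient.

Variables (F : fieldType) (vT : vectType F) (U W : {vspace vT}).

Definition quot : vectType F := subvs_of (U :\: W)%VS.

Definition quot_pi (v : vT) : quot := vsproj (U :\: W)%VS (addv_pi1 U W v).

Definition quot_act N (rho : 'M[F]_N -> vT -> vT) (g : 'M[F]_N) (x : quot) :
    quot :=
  quot_pi (rho g (vsval x)).

Lemma quot_pi_linear : linear quot_pi.
Proof. by move=> a u v; rewrite /quot_pi !linearP. Qed.

Lemma quot_piK (x : quot) : quot_pi (vsval x) = x.
Proof.
rewrite /quot_pi /addv_pi1 daddv_pi_id ?vsvalK ?subvsP //.
exact: capv_diff.
Qed.

Lemma quot_pi_sub v : v \in U -> (W <= U)%VS -> v - vsval (quot_pi v) \in W.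
Proof.
move=> Uv sWU; have UWv : v \in (U + W)%VS by rewrite (addv_idPl sWU).
rewrite /quot_pi vsprojK; last exact: memv_pi.
by rewrite -{1}(addv_pi1_pi2 UWv) addrAC subrr add0r memv_pi2.
Qed.

Lemma quot_pi_eq0 v : v \in U -> (W <= U)%VS -> (quot_pi v == 0) = (v \in W).
Proof.
move=> Uv sWU; apply/eqP/idP => [pv0 | Wv].
  by have := quot_pi_sub Uv sWU; rewrite pv0 subr0.
have Ww := quot_pi_sub Uv sWU; apply: val_inj; apply/eqP.
rewrite -memv0 -(capv_diff U W) memv_cap subvsP /=.
by rewrite -[vsval _](subKr v) rpredB.
Qed.

Lemma quot_act_pi N (rho : 'M[F]_N -> vT -> vT) g v :
    linear (rho g) -> (forall u, u \in U -> rho g u \in U) ->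
    (forall u, u \in W -> rho g u \in W) -> (W <= U)%VS -> v \in U ->
  quot_act rho g (quot_pi v) = quot_pi (rho g v).
Proof.
move=> lin_g gU gW sWU Uv.
pose pL := GRing.isLinear.Build _ _ _ _ quot_pi quot_pi_linear.
pose p : {linear vT -> quot} := HB.pack quot_pi pL.
pose rL := GRing.isLinear.Build _ _ _ _ (rho g) lin_g.
pose r : {linear vT -> vT} := HB.pack (rho g) rL.
apply/esym/eqP; rewrite -subr_eq0.
rewrite -[_ - _]/(p (r v) - p (r (vsval (quot_pi v)))) -!linearB /=.
by rewrite quot_pi_eq0 ?gW ?quot_pi_sub // (subvP sWU) ?gW ?quot_pi_sub.
Qed.

End Quotient.

(** [Sym V] is the polynomial algebra on the basis [vbasis fullv] of [V], and
    [Sym^r V] its homogeneous part of degree [r]; [sym_inj] is the inclusion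
    of [V] as the polynomials of degree one. *)
Notation Sym F V := {mpoly F[\dim (fullv : {vspace V})]}.

Section SymmetricAlgebra.

Variables (F : fieldType) (V : vectType F).

Definition sym_inj (v : V) : Sym F V :=
  \sum_i coord (vbasis {:V}) i v *: 'X_i.

Definition Sym_deg (r : nat) (f : Sym F V) : Prop :=
  f \is r.-homog.

Variables (N : nat) (rho : 'M[F]_N -> V -> V).

Definition sym_act (g : 'M[F]_N) (f : Sym F V) :
    Sym F V :=
  f \mPo [tuple sym_inj (rho g (vbasis {:V})`_i) | i < \dim {:V}].

Definition dual : vectType F := 'Hom(V, F^o).

Definition dual_act (g : 'M[F]_N) (phi : dual) : dual :=
  linfun (fun v => phi (rho (invmx g) v)).

End SymmetricAlgebra.

Definition irreducible_elt (A : idomainType) (f : A) : Prop :=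
  [/\ f != 0, f \isn't a GRing.unit &
      forall a b : A, f = a * b -> a \is a GRing.unit \/ b \is a GRing.unit].

(** Matrix indices start at 0, so the blocks of [P_k] are [i < k] and
    [k <= i]. *)
Section Groups.

Variables (F : fieldType) (n k : nat).
Implicit Types g A : 'M[F]_n.+1.

(* The upper right block vanishes: the Lie algebra contains all negative root
   spaces, and no root space of a positive root involving alpha_k. *)
Definition parabolic g : Prop :=
  \det g = 1 /\ forall i j : 'I_n.+1, (i < k <= j)%N -> g i j = 0.

Definition levi g : Prop :=
  \det g = 1 /\ forall i j : 'I_n.+1, (i < k)%N != (j < k)%N -> g i j = 0.

Definition torus g : Prop :=
  \det g = 1 /\ forall i j : 'I_n.+1, i != j -> g i j = 0.

Definition levi_unipotent g : Prop :=
  [/\ levi g, forall i : 'I_n.+1, g i i = 1 &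
      forall i j : 'I_n.+1, (j < i)%N -> g i j = 0].

Definition adjoint g A : 'M[F]_n.+1 := g *m A *m invmx g.

Definition sl_space : {vspace 'M[F]_n.+1} :=
  lker (linfun (fun A : 'M[F]_n.+1 => \tr A : F^o)).

Definition parabolic_lie : {vspace 'M[F]_n.+1} :=
  (sl_space :&:
   \bigcap_(p : 'I_n.+1 * 'I_n.+1 | (p.1 < k <= p.2)%N)
      lker (linfun (fun A : 'M[F]_n.+1 => A p.1 p.2 : F^o)))%VS.

(* g / p_k with the action of P_k induced by the adjoint action, that is, the
   P_k-module of the tangent bundle *)
Definition tangent : vectType F := quot sl_space parabolic_lie.

Definition tangent_act : 'M[F]_n.+1 -> tangent -> tangent :=
  quot_act (U := sl_space) (W := parabolic_lie) adjoint.

Lemma mem_sl A : (A \in sl_space) = (\tr A == 0).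
Proof.
pose f (B : 'M[F]_n.+1) := \tr B : F^o.
have fL : linear f by move=> a u v; rewrite /f linearP.
pose h : {linear 'M[F]_n.+1 -> F^o} :=
  HB.pack f (GRing.isLinear.Build _ _ _ _ f fL).
by rewrite memv_ker -[linfun _]/(linfun h) lfunE.
Qed.

Lemma mem_parabolic_lie A :
  reflect (\tr A = 0 /\ forall i j : 'I_n.+1, (i < k <= j)%N -> A i j = 0)
          (A \in parabolic_lie).
Proof.
have entry p : (A \in lker (linfun (fun B : 'M[F]_n.+1 => B p.1 p.2 : F^o)))
    = (A p.1 p.2 == 0).
  pose f (B : 'M[F]_n.+1) := B p.1 p.2 : F^o.
  have fL : linear f by move=> a u v; rewrite /f !mxE.
  pose h : {linear 'M[F]_n.+1 -> F^o} :=
    HB.pack f (GRing.isLinear.Build _ _ _ _ f fL).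
  by rewrite memv_ker -[linfun _]/(linfun h) lfunE.
rewrite memv_cap mem_sl memvE.
apply: (iffP andP) => [[/eqP trA /subv_bigcapP A0] | [trA A0]].
  by split=> // i j ij; apply/eqP; rewrite -(entry (i, j)) memvE A0.
split; first exact/eqP.
by apply/subv_bigcapP => p /A0/eqP; rewrite -entry memvE.
Qed.

End Groups.

(** Weights are given by their coordinates on the fundamental weights. *)
Section Weights.

Variables (F : fieldType) (n : nat).

Definition weight := 'rV[int]_n.

(* lambda_j, for 1 <= j <= n *)
Definition fweight (j : nat) : weight := \row_(a < n) (a.+1 == j)%:R.

(* lambda_j is the character t |-> t_1 ... t_j of the diagonal torus *)
Definition weight_char (l : weight) (t : 'M[F]_n.+1) : F :=
  \prod_(j < n) (\prod_(a < n.+1 | (a <= j)%N) t a a) ^ (l 0 j).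

Variables (k : nat) (W : lmodType F) (rho : 'M[F]_n.+1 -> W -> W).

(* with respect to the Levi part and its upper triangular Borel subgroup *)
Definition highest_weight_vector (l : weight) (v : W) : Prop :=
  [/\ v != 0, forall u, levi_unipotent k u -> rho u v = v &
      forall t, torus t -> rho t v = weight_char l t *: v].

(* [S] is a P_k-submodule of [W] isomorphic to E_l, which is characterised up
   to isomorphism by irreducibility and highest weight *)
Definition is_E (l : weight) (S : W -> Prop) : Prop :=
  irreducible_module (@parabolic F n k) rho S /\
  exists2 v, S v & highest_weight_vector l v.

End Weights.

(** Fundamental highest weights of a module [V] of the Levi part: the algebra
    [P(V)] is [Sym] of the dual of [V].  The notion is meant for [V] such that
    [poly_multiplicity_free] holds. *)
Section FundamentalHighestWeights.

Variables (F : fieldType) (n k : nat) (V : vectType F).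
Variable rho : 'M[F]_n.+1 -> V -> V.

Definition poly_act := sym_act (dual_act rho).

Definition poly_multiplicity_free : Prop :=
  multiplicity_free (@levi F n k) poly_act.

(* [msize] is one more than the total degree *)
Definition fundamental_highest_weight (l : weight n) (d : nat) : Prop :=
  exists S, irreducible_module (@levi F n k) poly_act S /\
  exists h : Sym F (dual V),
    [/\ S h, highest_weight_vector k poly_act l h, irreducible_elt h &
        msize h = d.+1].

End FundamentalHighestWeights.

(* Main.v *)
From HB Require Import structures.
From Stdlib Require Import Classical.
From mathcomp Require Import all_boot all_order fingroup perm all_algebra ring.
From mathcomp Require Import reals complex mpoly.
Require Import Defs.

Set Implicit Arguments.
Unset Strict Implicit.
Unset Printing Implicit Defensive.

Import Order.TTheory GRing.Theory Num.Theory.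

Local Open Scope ring_scope.

(** The bundle [T_X] corresponds to the module of [k * m] matrices, [m = n + 1 -
    k], on which an element of the parabolic group with diagonal blocks [A] and
    [D] acts by [M |-> A M D^-1], and [Sym T_X] is the algebra of polynomials in
    the entries of a matrix of variables [Z].  With the columns read backwards,
    the unipotent elements of the Levi group act by [f(Z) |-> f(L Z U)] with [L]
    lower and [U] upper unitriangular, so that they fix the leading minors of
    [Z], and the leading minor of size [j] has weight [lambda_j +
    lambda_(n+1-j)].

    Highest weight vectors are the monomials in the leading minors
    ([highest_weight_lmon]): by Gaussian elimination a polynomial fixed by the
    unipotent group is determined by its values on diagonal matrices
    ([elimination]); there a torus eigenvector is a monomial, its exponents
    decrease ([dgm_monomial_decr]), and so some monomial in the leading minors
    has the same values.  Every nonzero submodule contains such a vector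
    ([exists_highest_weight]): a torus eigenvector of maximal height is fixed by
    the unipotent group.

    Complete reducibility comes from the Fischer inner product, for which the
    adjoint of an element is its conjugate transpose ([fischer_msubst]).  The
    submodules generated by different monomials in the minors are orthogonal
    ([fischer_rho_lmon], again by elimination), so each of them is irreducible,
    and the orthogonal complement of their sum, a submodule containing none of
    these monomials, is zero.

    Distinct monomials have distinct weights, which gives multiplicity freeness.
    A product of at least two minors is reducible, while a single minor is an
    irreducible polynomial: it has degree one in each of its rows and columns,
    and a factor involving a row must involve all the columns
    ([gminor_irreducible]).  The algebra of polynomials on the cotangent
    module is the symmetric algebra of the double dual of the tangent module;
    both it and [Sym T_X] are identified with the polynomials in [Z]. *)

(** * Polynomials under linear substitutions *)

Section Substitution.

Variable F : fieldType.

Lemma mpoly_mon_ind D (P : {mpoly F[D]} -> Prop) :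
  P 0 -> (forall a p q, P p -> P q -> P (a *: p + q)) -> P 1 ->
  (forall i p, P p -> P ('X_i * p)) -> forall p, P p.
Proof.
move=> P0 PL P1 PX; elim/mpolyind => [|c m p _ _ Pp] //.
apply: (PL) => //; rewrite mpolyXE_id.
elim: (index_enum _) => [|i r IHr]; first by rewrite big_nil.
rewrite big_cons; elim: (m i) => [|e IHe]; first by rewrite expr0 mul1r.
by rewrite exprS -mulrA; apply: (PX).
Qed.

Lemma mpoly_alg_ind D (P : {mpoly F[D]} -> Prop) :
  (forall c, P c%:MP) -> (forall i, P 'X_i) ->
  (forall p q, P p -> P q -> P (p + q)) ->
  (forall p q, P p -> P q -> P (p * q)) -> forall p, P p.
Proof.
move=> PC PX PD PM; apply: mpoly_mon_ind => [|a p q Pp Pq||i p Pp].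
- by rewrite -mpolyC0.
- by apply: (PD) => //; rewrite -mul_mpolyC; apply: (PM).
- by rewrite -mpolyC1.
- exact: (PM).
Qed.

Lemma comp_mpolyA D1 D2 D3 (p : {mpoly F[D1]}) (u : D1.-tuple {mpoly F[D2]})
    (v : D2.-tuple {mpoly F[D3]}) :
  (p \mPo u) \mPo v = p \mPo [tuple tnth u i \mPo v | i < D1].
Proof.
elim/mpoly_alg_ind: p => [c|i|p q IHp IHq|p q IHp IHq].
- by rewrite !comp_mpolyC.
- by rewrite !comp_mpolyXU -!tnth_nth tnth_mktuple.
- by rewrite !raddfD /= IHp IHq.
- by rewrite !rmorphM /= IHp IHq.
Qed.

Definition lform D (u : 'rV[F]_D) : {mpoly F[D]} := \sum_i u 0 i *: 'X_i.

Lemma lform_is_linear D : linear (@lform D).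
Proof.
move=> a u v; rewrite /lform scaler_sumr -big_split /=.
by apply: eq_bigr => i _; rewrite !mxE scalerDl scalerA.
Qed.

HB.instance Definition _ D :=
  GRing.isLinear.Build F 'rV[F]_D {mpoly F[D]} _ (@lform D) (@lform_is_linear
    D).

Lemma lform_delta D i : lform (delta_mx 0 i : 'rV[F]_D) = 'X_i.
Proof.
rewrite /lform (bigD1 i) //= mxE !eqxx scale1r big1 ?addr0 // => j ji.
by rewrite mxE eqxx (negPf ji) scale0r.
Qed.

Lemma meval_lform D (u : 'rV[F]_D) (z : 'I_D -> F) :
  (lform u).@[z] = \sum_i u 0 i * z i.
Proof.
by rewrite raddf_sum; apply: eq_bigr => i _ /=; rewrite mevalZ mevalXU.
Qed.

Definition msubst D (K : 'M[F]_D) (f : {mpoly F[D]}) : {mpoly F[D]} :=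
  f \mPo [tuple lform (row i K) | i < D].

HB.instance Definition _ D (K : 'M[F]_D) :=
  GRing.LRMorphism.copy (msubst K) (comp_mpoly [tuple lform (row i K) | i < D]).

Lemma msubstXU D (K : 'M[F]_D) i : msubst K 'X_i = lform (row i K).
Proof. by rewrite /msubst comp_mpolyXU -tnth_nth tnth_mktuple. Qed.

Lemma msubst_lform D (K : 'M[F]_D) u : msubst K (lform u) = lform (u *m K).
Proof.
rewrite mulmx_sum_row !linear_sum; apply: eq_bigr => i _.
by rewrite !linearZ /= msubstXU.
Qed.

Lemma msubst_comp D (K L : 'M[F]_D) f :
  msubst K (msubst L f) = msubst (L *m K) f.
Proof.
rewrite {1 2}/msubst comp_mpolyA; congr (_ \mPo _).
apply: eq_from_tnth => i; rewrite !tnth_mktuple row_mul.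
exact: msubst_lform.
Qed.

Lemma msubst1 D (f : {mpoly F[D]}) : msubst 1%:M f = f.
Proof.
rewrite -[RHS]comp_mpoly_id; congr (_ \mPo _).
by apply: eq_from_tnth => i; rewrite !tnth_mktuple row1 lform_delta.
Qed.

Lemma meval_msubst D (K : 'M[F]_D) f (z : 'rV[F]_D) :
  (msubst K f).@[z 0] = f.@[(z *m K^T) 0].
Proof.
rewrite /msubst comp_mpoly_meval; apply: meval_eq => i.
rewrite tnth_mktuple meval_lform mxE; apply: eq_bigr => j _.
by rewrite !mxE mulrC.
Qed.

Lemma lform_homog D (u : 'rV[F]_D) : lform u \is 1.-homog.
Proof.
apply: rpred_sum => i _; apply: rpredZ.
by rewrite dhomogX /= mdeg1.
Qed.

Lemma comp_mpoly_homog D1 D2 (u : D1.-tuple {mpoly F[D2]}) r f :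
  (forall i, tnth u i \is 1.-homog) -> f \is r.-homog -> f \mPo u \is r.-homog.
Proof.
move=> u1 /dhomogP fr; rewrite comp_mpolyEX big_seq; apply: rpred_sum => m mf.
apply: rpredZ; rewrite comp_mpolyX -(fr _ mf) /= mdegE.
apply: (big_ind2 (fun (p : {mpoly F[D2]}) (d : nat) => p \is d.-homog)).
- exact: dhomog1.
- by move=> p d q e; apply: dhomogM.
- by move=> i _; rewrite -[X in X.-homog]mul1n; apply: dhomogMn.
Qed.

Lemma msubst_homog D (K : 'M[F]_D) r f :
  f \is r.-homog -> msubst K f \is r.-homog.
Proof.
by apply: comp_mpoly_homog => i; rewrite tnth_mktuple lform_homog.
Qed.

(** Matrix entries and inner products of substituted polynomials thus depend
    polynomially on a parameter, which elimination requires. *)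
Lemma msubst_line D (K L : 'M[F]_D) f :
  exists P : {poly {mpoly F[D]}}, forall s, msubst (K + s *: L) f = P.[s%:MP].
Proof.
elim/mpoly_alg_ind: f => [c|i|p q [P Pp] [Q Qq]|p q [P Pp] [Q Qq]].
- exists (c%:MP)%:P => s; rewrite hornerC; exact: comp_mpolyC.
- exists ((lform (row i K))%:P + (lform (row i L)) *: 'X) => s.
  rewrite !hornerE msubstXU.
  have -> : row i (K + s *: L) = row i K + s *: row i L.
    by apply/rowP => j; rewrite !mxE.
  by rewrite linearD linearZ /= mulrC mul_mpolyC.
- by exists (P + Q) => s; rewrite hornerD raddfD /= Pp Qq.
- by exists (P * Q) => s; rewrite hornerM rmorphM /= Pp Qq.
Qed.

Definition mchar D (t : 'rV[F]_D) (m : 'X_{1..D}) : F := \prod_i t 0 i ^+ m i.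

Lemma mcoeff_diag D (t : 'rV[F]_D) f m :
  (msubst (diag_mx t) f)@_m = mchar t m * f@_m.
Proof.
rewrite {1}(mpolyE f) (linear_sum (msubst (diag_mx t))) raddf_sum /=.
have eX m' : msubst (diag_mx t) 'X_[m'] = mchar t m' *: 'X_[m'].
  rewrite /msubst comp_mpolyX [in RHS]mpolyXE_id -scaler_prod.
  apply: eq_bigr => i _; rewrite tnth_mktuple -exprZn; congr (_ ^+ _).
  rewrite -(lform_delta i) -linearZ; congr lform; apply/rowP => j.
  rewrite !mxE eqxx /= [j == i]eq_sym.
  by case: (i =P j) => [->|]; rewrite ?mulr1 ?mulr0.
rewrite (eq_bigr (fun m' => f@_m' * mchar t m' * (m' == m)%:R)); last first.
  by move=> m' _; rewrite linearZ /= eX scalerA mcoeffZ mcoeffX.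
have [mf|mNf] := boolP (m \in msupp f).
  rewrite (bigD1_seq m) ?msupp_uniq //= eqxx mulr1 big1 ?addr0 1?mulrC //.
  by move=> m' /negPf ->; rewrite mulr0.
rewrite (memN_msupp_eq0 mNf) mulr0 big_seq big1 // => m' m'f.
by case: eqP => [e|]; rewrite ?mulr0 //; rewrite -e m'f in mNf.
Qed.

End Substitution.

(** * Diagonal substitutions *)

Section Subspaces.

Variables (F : fieldType) (W : lmodType F) (S : W -> Prop).
Hypothesis subS : subspace S.

Lemma subspaceD u v : S u -> S v -> S (u + v).
Proof. by move=> Su Sv; rewrite -[u]scale1r; apply: subS.2. Qed.

Lemma subspaceZ a u : S u -> S (a *: u).
Proof. by move=> Su; rewrite -[_ *: _]addr0; apply: subS.2 => //;
  apply: subS.1. Qed.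

Lemma subspaceB u v : S u -> S v -> S (u - v).
Proof. by move=> Su Sv; rewrite -scaleN1r; apply: subspaceD;
  last exact: subspaceZ. Qed.

End Subspaces.

(** A nonzero element of least support in [S] among those supported in that of
    [f] is a common eigenvector: otherwise two of its monomials are scaled
    differently by some [t], and subtracting a multiple of it from its image
    under [t] kills one monomial without killing the other. *)
Lemma torus_vector (F : fieldType) D (S : {mpoly F[D]} -> Prop)
    (T : 'rV[F]_D -> Prop) f :
  subspace S -> (forall t g, T t -> S g -> S (msubst (diag_mx t) g)) ->
  S f -> f != 0 ->
  exists g, [/\ S g, g != 0, {subset msupp g <= msupp f} &
    forall t m m', T t -> m \in msupp g -> m' \in msupp g ->
      mchar t m = mchar t m'].
Proof.
move=> subS TS; have [n] := ubnP (size (msupp f)).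
elim: n f => // n IHn f lefn Sf f0.
case: (classic (exists t m m', [/\ T t, m \in msupp f, m' \in msupp f
  & mchar t m != mchar t m'])) => [[t [m [m' [Tt mf m'f neq]]]]|no]; last first.
  exists f; split=> // t m m' Tt mf m'f; apply/eqP/negPn/negP => neq.
  by apply: no; exists t, m, m'.
pose g := msubst (diag_mx t) f - mchar t m *: f.
have coefg m2 : g@_m2 = (mchar t m2 - mchar t m) * f@_m2.
  by rewrite mcoeffB mcoeffZ mcoeff_diag mulrBl.
have Sg : S g by apply: subspaceB => //; [apply: TS | apply: subspaceZ].
have gf : {subset msupp g <= rem m (msupp f)}.
  move=> m2; rewrite (rem_filter _ (msupp_uniq f)) mem_filter !mcoeff_msupp
    coefg.
  rewrite mulf_eq0 negb_or => /andP[h ->]; rewrite andbT.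
  by apply: contraNneq h => /= ->; rewrite subrr.
have g0 : g != 0.
  apply: contraTneq (m'f) => g0; rewrite mcoeff_msupp negbK.
  move/(congr1 (mcoeff m')): g0; rewrite coefg mcoeff0 => /eqP.
  by rewrite mulf_eq0 subr_eq0 eq_sym (negPf neq).
case: (IHn g) => // [|h [Sh h0 hg hT]].
  apply: leq_ltn_trans (uniq_leq_size (msupp_uniq _) gf) _.
  rewrite size_rem // -ltnS prednK //.
  by case: (msupp f) mf.
by exists h; split=> // m2 /hg/gf/mem_rem.
Qed.

Lemma mchar_single (F : fieldType) D (i : 'I_D) (c : F) m :
  mchar (\row_j (if j == i then c else 1)) m = c ^+ m i.
Proof.
rewrite /mchar (bigD1 i) //= mxE eqxx big1 ?mulr1 // => j /negPf ji.
by rewrite mxE ji expr1n.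
Qed.

Lemma expr2_inj (F : numDomainType) : injective (GRing.exp (2 : F)).
Proof. by apply: ieexprIn; rewrite ?ltr0n // pnatr_eq1. Qed.

Lemma msupp1E (F : fieldType) D (f : {mpoly F[D]}) m :
  (forall m', m' \in msupp f -> m' = m) -> f = f@_m *: 'X_[m].
Proof.
move=> fm; apply/mpolyP => m'; rewrite mcoeffZ mcoeffX.
have [<-|neq] := eqVneq m m'; first by rewrite mulr1.
rewrite mulr0; apply/eqP; rewrite mcoeff_eq0; apply: contraNN neq.
by move/fm ->.
Qed.

(** The polynomials vanishing everywhere are stable under all scalings of the
    variables, so if there were a nonzero one there would be a monomial. *)
Lemma mpoly_eval_eq0 (F : numFieldType) D (f : {mpoly F[D]}) :
  (forall z : 'rV_D, f.@[z 0] = 0) -> f = 0.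
Proof.
move=> f0; apply/eqP/negPn/negP => nz.
pose S (f : {mpoly F[D]}) := forall z : 'rV_D, f.@[z 0] = 0.
have subS : subspace S.
  split=> [z|a u v Su Sv z]; first by rewrite meval0.
  by rewrite mevalD mevalZ Su Sv mulr0 addr0.
have [|g [Sg g0 _ gT]] := torus_vector (T := fun=> True) subS _ f0 nz.
  by move=> t g _ Sg z; rewrite meval_msubst Sg.
have gm := @msupp1E _ _ g (mlead g).
move: (Sg (const_mx 1)); rewrite {1}gm.
  rewrite mevalZ mevalX big1 ?mulr1.
    by move/eqP; rewrite mcoeff_eq0 mlead_supp.
  by move=> i _; rewrite mxE expr1n.
move=> m mg; apply/mnmP => i.
have := gT (\row_j (if j == i then 2 else 1)) m _ I mg (mlead_supp g0).
by rewrite !mchar_single => /expr2_inj.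
Qed.

(** * The Fischer inner product *)

Section Fischer.

Variables (C : numClosedFieldType) (D : nat).
Implicit Types f g h : {mpoly C[D]}.

Definition mfact (m : 'X_{1..D}) : nat := (\prod_i (m i)`!)%N.

Definition fischer f g : C :=
  \sum_(m <- msupp f) (mfact m)%:R * f@_m * (g@_m)^*.

Lemma fischerE s f g : uniq s -> {subset msupp f <= s} ->
  fischer f g = \sum_(m <- s) (mfact m)%:R * f@_m * (g@_m)^*.
Proof.
move=> us fs; rewrite [RHS](bigID (mem (msupp f))) /= [X in _ + X]big1 ?addr0.
  rewrite -big_filter; apply: perm_big.
  apply: uniq_perm; rewrite ?msupp_uniq ?filter_uniq // => m.
  by rewrite mem_filter; case: (boolP (m \in msupp f)) => // /fs ->.
by move=> m /memN_msupp_eq0 ->; rewrite mulr0 mul0r.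
Qed.

Lemma fischer_linear a f h g :
  fischer (a *: f + h) g = a * fischer f g + fischer h g.
Proof.
pose s := undup (msupp f ++ msupp h).
have us : uniq s by apply: undup_uniq.
have sf : {subset msupp f <= s}.
  by move=> m mf; rewrite mem_undup mem_cat mf.
have sh : {subset msupp h <= s}.
  by move=> m mh; rewrite mem_undup mem_cat mh orbT.
rewrite !(@fischerE s) //; last first.
  move=> m /msuppD_le; rewrite mem_cat => /orP[/msuppZ_le/sf|/sh] //.
rewrite mulr_sumr -big_split; apply: eq_bigr => m _ /=.
by rewrite mcoeffD mcoeffZ mulrDr mulrDl mulrCA !mulrA.
Qed.

Lemma fischer0l g : fischer 0 g = 0.
Proof. by rewrite /fischer msupp0 big_nil. Qed.
Lemma fischerDl f h g : fischer (f + h) g = fischer f g + fischer h g.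
Proof. by rewrite -[f]scale1r fischer_linear mul1r scale1r. Qed.
Lemma fischerZl a f g : fischer (a *: f) g = a * fischer f g.
Proof. by rewrite -[_ *: _]addr0 fischer_linear fischer0l addr0. Qed.
Lemma fischerBl f h g : fischer (f - h) g = fischer f g - fischer h g.
Proof. by rewrite fischerDl -scaleN1r fischerZl mulN1r. Qed.
Lemma fischer_suml (I : Type) (r : seq I) P (w : I -> {mpoly C[D]}) g :
  fischer (\sum_(i <- r | P i) w i) g = \sum_(i <- r | P i) fischer (w i) g.
Proof.
apply: (big_morph (fun f => fischer f g)) => [f h|]; first exact: fischerDl.
exact: fischer0l.
Qed.

Lemma fischerC f g : fischer g f = (fischer f g)^*.
Proof.
pose s := undup (msupp f ++ msupp g).
rewrite !(@fischerE s) ?undup_uniq //; last 2 first.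
- by move=> m mf; rewrite mem_undup mem_cat mf.
- by move=> m mh; rewrite mem_undup mem_cat mh orbT.
rewrite rmorph_sum; apply: eq_bigr => m _ /=.
by rewrite !rmorphM /= conjCK rmorph_nat mulrAC.
Qed.

Lemma fischerDr f g h : fischer f (g + h) = fischer f g + fischer f h.
Proof. by rewrite ![fischer f _]fischerC fischerDl rmorphD. Qed.
Lemma fischerZr a f g : fischer f (a *: g) = a^* * fischer f g.
Proof. by rewrite ![fischer f _]fischerC fischerZl rmorphM. Qed.
Lemma fischer_sumr (I : Type) (r : seq I) P (w : I -> {mpoly C[D]}) f :
  fischer f (\sum_(i <- r | P i) w i) = \sum_(i <- r | P i) fischer f (w i).
Proof.
rewrite fischerC fischer_suml rmorph_sum; apply: eq_bigr => i _.
by rewrite [RHS]fischerC.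
Qed.
Lemma fischer0r f : fischer f 0 = 0.
Proof. by rewrite fischerC fischer0l rmorph0. Qed.

Lemma fischer_eq0 f : fischer f f = 0 -> f = 0.
Proof.
move=> ff0; apply/eqP/negPn/negP => /mlead_supp nz.
move: ff0; rewrite /fischer (bigD1_seq (mlead f)) ?msupp_uniq //=.
have pos m : 0 <= (mfact m)%:R * f@_m * (f@_m)^*.
  by rewrite -mulrA mulr_ge0 ?ler0n // mul_conjC_ge0.
move/eqP; rewrite paddr_eq0 ?sumr_ge0 // => /andP[+ _].
rewrite -mulrA mulf_eq0 pnatr_eq0 mul_conjC_eq0 mcoeff_eq0 nz /= orbF.
by rewrite -leqn0 leqNgt prodn_gt0 // => i; apply: fact_gt0.
Qed.

Lemma fischerX m g : fischer 'X_[m] g = (mfact m)%:R * (g@_m)^*.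
Proof. by rewrite /fischer msuppX big_seq1 mcoeffX eqxx mulr1. Qed.

(** Multiplication by a variable is adjoint to its partial derivative, the
    factorials in the inner product being there for that purpose. *)
Lemma fischer_mulX i f g : fischer ('X_i * f) g = fischer f g^`M(i).
Proof.
rewrite {1}(mpolyE f) mulr_sumr fischer_suml [in RHS](mpolyE f) fischer_suml.
apply: eq_bigr => m _; rewrite -scalerAr !fischerZl; congr (_ * _).
rewrite -mpolyXD !fischerX mcoeff_deriv addmC -[g@__ *+ _]mulr_natl rmorphM /=.
rewrite rmorph_nat.
rewrite mulrA -natrM; congr (_%:R * _).
rewrite /mfact (bigD1 i) //= [in RHS](bigD1 i) //= mnmDE mnm1E eqxx addn1.
rewrite factS mulnAC mulnC -!mulnA; congr (_ * _)%N; rewrite mulnC.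
congr (_ * _)%N; apply: eq_bigr => j /negPf ji.
by rewrite mnmDE mnm1E eq_sym ji addn0.
Qed.

Lemma mderiv_msubst (K : 'M[C]_D) i f :
  (msubst K f)^`M(i) = \sum_j K j i *: msubst K f^`M(j).
Proof.
elim/mpoly_alg_ind: f => [c|l|p q IHp IHq|p q IHp IHq].
- rewrite /msubst comp_mpolyC mderivC big1 // => j _.
  by rewrite mderivC comp_mpoly0 scaler0.
- rewrite msubstXU {1}/lform raddf_sum /=.
  have dX (a b : 'I_D) : ('X_a : {mpoly C[D]})^`M(b) = (a == b)%:R.
    rewrite mderivX mnm1E; case: eqP => [->|_]; rewrite ?scale0r //.
    rewrite scale1r (_ : (U_(b) - U_(b))%MM = 0%MM) ?mpolyX0 //.
    by apply/mnmP => j; rewrite mnmBE subnn mnm0E.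
  rewrite (bigD1 i) //= big1 ?addr0; last first.
    by move=> j /negPf ji; rewrite mderivZ dX ji scaler0.
  rewrite (bigD1 l) //= [X in _ + X]big1 ?addr0; last first.
    by move=> j /negPf jl; rewrite dX eq_sym jl /msubst comp_mpoly0 scaler0.
  by rewrite mderivZ !dX !eqxx /msubst comp_mpoly1 !mxE.
- rewrite raddfD /= mderivD IHp IHq -big_split; apply: eq_bigr => j _ /=.
  by rewrite mderivD [msubst K (_ + _)]raddfD /= scalerDr.
- rewrite rmorphM /= mderivM IHp IHq mulr_suml mulr_sumr -big_split.
  apply: eq_bigr => j _ /=.
  by rewrite mderivM raddfD /= !rmorphM /= scalerDr -scalerAl -scalerAr.
Qed.

Lemma mcoeff0_lform (u : 'rV[C]_D) : (lform u)@_0 = 0.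
Proof.
apply: (dhomog_nemf_coeff (lform_homog u)).
by rewrite /= mdeg0.
Qed.

Lemma mcoeff0_msubst (K : 'M[C]_D) f : (msubst K f)@_0 = f@_0.
Proof.
elim/mpoly_mon_ind: f => [|a p q IHp IHq||i p IHp].
- by rewrite raddf0.
- by rewrite linearP /= !mcoeffD !mcoeffZ IHp IHq.
- by rewrite rmorph1.
- by rewrite rmorphM /= !rmorphM /= msubstXU mcoeff0_lform mcoeffX mnm1_eq0
    !mul0r.
Qed.

Definition ctrmx D1 D2 (K : 'M[C]_(D1, D2)) : 'M[C]_(D2, D1) :=
  (map_mx Num.conj K)^T.

(** The adjoint of a linear substitution is the substitution by the conjugate
    transpose, by induction on [f]: variables move across the product as partial
    derivatives and return by the chain rule. *)
Lemma fischer_msubst (K : 'M[C]_D) f g :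
  fischer (msubst K f) g = fischer f (msubst (ctrmx K) g).
Proof.
elim/mpoly_mon_ind: f g => [|a p q IHp IHq||i p IHp] g.
- by rewrite raddf0 !fischer0l.
- by rewrite linearP /= !fischer_linear IHp IHq.
- by rewrite rmorph1 -mpolyX0 !fischerX mcoeff0_msubst.
- rewrite rmorphM /= msubstXU fischer_mulX mderiv_msubst fischer_sumr.
  rewrite /lform mulr_suml fischer_suml; apply: eq_bigr => j _.
  by rewrite -scalerAl fischerZl fischer_mulX IHp fischerZr !mxE conjCK.
Qed.

(** Orthogonal projection onto a subspace of bounded support, by induction on
    the support: the elements of [S] without the monomial [m] form a hyperplane
    of [S] or all of it, and Gram-Schmidt applies. *)
Lemma fischer_proj (l : seq 'X_{1..D}) (S : {mpoly C[D]} -> Prop) :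
  subspace S -> (forall f, S f -> {subset msupp f <= l}) ->
  forall f, exists2 u, S u & forall w, S w -> fischer (f - u) w = 0.
Proof.
elim: l S => [|m l IHl] S subS Sl f.
  exists 0 => [|w Sw]; first exact: subS.1.
  suff -> : w = 0 by rewrite fischer0r.
  by apply: msuppnil0; case: (msupp w) (Sl w Sw) =>
    // m r /(_ m (mem_head _ _)).
pose S0 g := S g /\ g@_m = 0.
have subS0 : subspace S0.
  split=> [|a u v [Su u0] [Sv v0]].
    by split; [apply: subS.1 | rewrite mcoeff0].
  by split; [apply: subS.2 | rewrite mcoeffD mcoeffZ u0 v0 mulr0 addr0].
have S0l g : S0 g -> {subset msupp g <= l}.
  move=> [Sg gm0] m' m'g; have := Sl g Sg m' m'g.
  rewrite inE => /predU1P[e|//].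
  by move: m'g; rewrite mcoeff_msupp e gm0 eqxx.
have [u0 [Su0 u0m] u0P] := IHl _ subS0 S0l f.
case: (classic (exists2 y, S y & y@_m != 0)) => [[y Sy ym]|no]; last first.
  exists u0 => // w Sw; apply: u0P; split=> //; apply/eqP/negPn/negP => wm.
  by apply: no; exists w.
have [v0 [Sv0 v0m] v0P] := IHl _ subS0 S0l y.
pose z := y - v0.
have zm : z@_m = y@_m by rewrite mcoeffB v0m subr0.
have Sz : S z by apply: subspaceB.
have zz : fischer z z != 0.
  by apply: contraNneq ym => /fischer_eq0 z0; rewrite -zm z0 mcoeff0.
exists (u0 + (fischer f z / fischer z z) *: z).
  by apply: subspaceD => //; apply: subspaceZ.
have uz : fischer (f - (u0 + (fischer f z / fischer z z) *: z)) z = 0.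
  rewrite fischerBl fischerDl fischerZl divfK //.
  suff -> : fischer u0 z = 0 by rewrite add0r subrr.
  by rewrite fischerC v0P ?rmorph0.
move=> w Sw; pose w0 := w - (w@_m / y@_m) *: z.
have S0w : S0 w0.
  split; first by apply: subspaceB => //; apply: subspaceZ.
  by rewrite mcoeffB mcoeffZ zm divfK ?subrr.
rewrite -[w](subrK ((w@_m / y@_m) *: z)) -/w0 fischerDr fischerZr uz mulr0
  addr0.
by rewrite opprD addrA fischerBl u0P // fischerZl (v0P w0 S0w) mulr0 subr0.
Qed.

End Fischer.

(** * Weighted degrees and the irreducibility of minors *)

Lemma size_mul_pred (R : idomainType) (p q : {poly R}) :
  p != 0 -> q != 0 -> (size (p * q)%R).-1 = ((size p).-1 + (size q).-1)%N.
Proof.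
move=> p0 q0; rewrite size_mul //; move: p0 q0; rewrite -!size_poly_gt0.
by case: (size p) => // a _; case: (size q) => // b _; rewrite addnS.
Qed.

Section WeightedDegree.

Variables (F : fieldType) (D : nat) (w : 'I_D -> nat).
Implicit Types f g : {mpoly F[D]}.

Definition wtdeg (m : 'X_{1..D}) : nat := (\sum_i w i * m i)%N.

(** Giving the variable of index [i] the degree [w i] in a new variable turns
    the weighted degree into the degree of univariate polynomials, which is
    additive over a domain. *)
Definition wgrade : {mpoly F[D]} -> {poly {mpoly F[D]}} :=
  mmap (polyC \o @mpolyC D F) (fun i => ('X_i)%:P * 'X^(w i)).

HB.instance Definition _ := GRing.RMorphism.copy wgrade
  (mmap (polyC \o @mpolyC D F) (fun i => ('X_i)%:P * 'X^(w i))).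

Lemma wgradeX m : wgrade 'X_[m] = ('X_[m])%:P * 'X^(wtdeg m).
Proof.
rewrite /wgrade mmapX /mmap1 [in RHS]mpolyXE_id /wtdeg -prodrXr rmorph_prod.
by rewrite -big_split; apply: eq_bigr => i _; rewrite /= exprMn rmorphXn exprM.
Qed.

Lemma coef_wgrade f e m : ((wgrade f)`_e)@_m = f@_m *+ (wtdeg m == e).
Proof.
rewrite {1}(mpolyE f) (raddf_sum wgrade) coef_sum raddf_sum /=.
rewrite [in RHS](mpolyE f) raddf_sum /= -sumrMnl; apply: eq_bigr => m' _.
rewrite -mul_mpolyC rmorphM /= wgradeX /wgrade mmapC /= mulrA -rmorphM /=.
rewrite coefCM coefXn mul_mpolyC mulr_natr mcoeffMn mcoeffZ mcoeffX.
by case: (m' =P m) => [->|_]; rewrite ?mulr0 ?mul0rn // eq_sym.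
Qed.

Definition wdeg f : nat := (size (wgrade f)).-1.

Lemma wgrade_neq0 f : f != 0 -> wgrade f != 0.
Proof.
apply: contraNneq => f0; apply/eqP/mpolyP => m.
by have := coef_wgrade f (wtdeg m) m; rewrite f0 coef0 eqxx mulr1n => <-.
Qed.

Lemma wdegM f g : f != 0 -> g != 0 -> wdeg (f * g) = (wdeg f + wdeg g)%N.
Proof.
move=> /wgrade_neq0 f0 /wgrade_neq0 g0; rewrite /wdeg (rmorphM wgrade).
exact: (size_mul_pred f0 g0).
Qed.

Lemma wdeg_eq0 f m : wdeg f = 0%N -> m \in msupp f -> wtdeg m = 0%N.
Proof.
rewrite mcoeff_msupp => f0; apply: contraNeq; rewrite -lt0n => m0.
have := coef_wgrade f (wtdeg m) m; rewrite eqxx mulr1n => <-.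
rewrite nth_default ?mcoeff0 //; apply: leq_trans m0.
by rewrite -[X in (_ <= X.+1)%N]f0 leqSpred.
Qed.

Lemma wdeg_homog f d :
  f != 0 -> (forall m, m \in msupp f -> wtdeg m = d) -> wdeg f = d.
Proof.
move=> f0 fd; rewrite /wdeg.
have -> : wgrade f = f%:P * 'X^d.
  apply/polyP => e; rewrite coefCM coefXn mulr_natr; apply/mpolyP => m.
  rewrite coef_wgrade mcoeffMn; have [/fd ->|/memN_msupp_eq0 ->] := boolP (m
    \in msupp f).
    by rewrite eq_sym.
  by rewrite !mul0rn.
by rewrite size_Cmul // size_polyXn.
Qed.

Lemma wdeg_unit f : f \is a GRing.unit -> wdeg f = 0%N.
Proof.
move=> fu; have f0 : f != 0 by apply: contraTneq fu => ->; rewrite unitr0.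
have fV0 : f^-1 != 0 by rewrite invr_eq0.
have := wdegM f0 fV0; rewrite mulrV // /wdeg rmorph1 size_poly1 => /esym/eqP.
by rewrite addn_eq0 => /andP[/eqP].
Qed.

End WeightedDegree.

Lemma wtdeg_eq0 D (w : 'I_D -> nat) m i :
  wtdeg w m = 0%N -> (0 < w i)%N -> m i = 0%N.
Proof.
move/eqP; rewrite sum_nat_eq0 => /forallP/(_ i) /=; rewrite muln_eq0.
by case/orP => /eqP ->.
Qed.

Lemma mpoly_const_unit (F : fieldType) D (f : {mpoly F[D]}) :
  f != 0 -> (forall m, m \in msupp f -> m = 0%MM) -> f \is a GRing.unit.
Proof.
move=> f0 /msupp1E fE; move: f0; rewrite fE mpolyX0 -mul_mpolyC mulr1.
rewrite mpolyC_eq0 => c0; apply: rmorph_unit.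
by rewrite unitfE.
Qed.

Definition mxvec_pos k m (v : 'I_(k * m)) : 'I_k * 'I_m :=
  enum_val (cast_ord (esym (mxvec_cast k m)) v).

Lemma mxvec_indexK k m (a : 'I_k) (b : 'I_m) :
  mxvec_pos (mxvec_index a b) = (a, b).
Proof. by rewrite /mxvec_pos /mxvec_index cast_ordK enum_rankK. Qed.

Section GenericMinor.

Variables (F : fieldType) (k m p : nat) (s : 'I_p -> 'I_k) (t : 'I_p -> 'I_m).
Hypotheses (s_inj : injective s) (t_inj : injective t).

Local Notation D := (k * m)%N.

Definition gminor : {mpoly F[D]} :=
  \det (\matrix_(i, j) 'X_(mxvec_index (s i) (t j))).

Lemma mxvec_index_inj a b a' b' :
  mxvec_index a b = mxvec_index a' b' :> 'I_D -> a = a' /\ b = b'.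
Proof. by move/cast_ord_inj/enum_rank_inj; case. Qed.

Definition minor_mon (u : 'S_p) : 'X_{1..D} :=
  (\sum_i U_(mxvec_index (s i) (t (u i))))%MM.

Lemma minor_monE u v :
  minor_mon u v = (\sum_i (mxvec_index (s i) (t (u i)) == v))%N.
Proof.
by rewrite mnm_sumE; apply: eq_bigr => i _; rewrite mnm1E.
Qed.

Lemma gminorE : gminor = \sum_(u : 'S_p) (-1) ^+ u *: 'X_[minor_mon u].
Proof.
apply: eq_bigr => u _; rewrite -mul_mpolyC rmorphXn rmorphN1; congr (_ * _).
rewrite /minor_mon (big_morph _ (@mpolyXD _ F) (@mpolyX0 _ F)).
by apply: eq_bigr => i _; rewrite mxE.
Qed.

Lemma minor_mon_inj : injective minor_mon.
Proof.
move=> u v uv; apply/permP => i.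
have : (0 < minor_mon v (mxvec_index (s i) (t (u i))))%N.
  by rewrite -uv minor_monE (bigD1 i) //= eqxx.
rewrite minor_monE lt0n sum_nat_eq0 negb_forall => /existsP[j] /=.
by rewrite eqb0 negbK => /eqP/mxvec_index_inj[/s_inj -> /t_inj].
Qed.

Lemma mcoeff_gminor u : gminor@_(minor_mon u) = (-1) ^+ u.
Proof.
rewrite gminorE raddf_sum (bigD1 u) //= mcoeffZ mcoeffX eqxx mulr1.
rewrite big1 ?addr0 // => v vu; rewrite mcoeffZ mcoeffX.
by rewrite (inj_eq minor_mon_inj) (negPf vu) mulr0.
Qed.

Lemma msupp_gminor mu : mu \in msupp gminor -> exists u, mu = minor_mon u.
Proof.
rewrite mcoeff_msupp gminorE raddf_sum => nz.
case: (pickP (fun u => minor_mon u == mu)) => [u /eqP <-|no]; first by exists u.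
move: nz; rewrite big1 ?eqxx // => u _.
by rewrite /= mcoeffZ mcoeffX no mulr0.
Qed.

Lemma gminor_neq0 : gminor != 0.
Proof.
apply/eqP => /(congr1 (mcoeff (minor_mon 1))).
by rewrite mcoeff_gminor mcoeff0 => /eqP; rewrite signr_eq0.
Qed.

Lemma gminor_homog : gminor \is p.-homog.
Proof.
apply/dhomogP => mu /msupp_gminor[u ->] /=.
rewrite mdeg_sum (eq_bigr (fun=> 1%N)) ?sum1_card ?card_ord // => i _.
by rewrite mdeg1.
Qed.

Definition row_wt (a : 'I_k) (v : 'I_D) : nat := (mxvec_pos v).1 == a.
Definition col_wt (P : pred 'I_m) (v : 'I_D) : nat := P (mxvec_pos v).2.

Lemma row_wtE a a' b : row_wt a (mxvec_index a' b) = (a' == a).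
Proof. by rewrite /row_wt mxvec_indexK. Qed.

Lemma col_wtE P a b : col_wt P (mxvec_index a b) = P b.
Proof. by rewrite /col_wt mxvec_indexK. Qed.

Lemma wtdeg_minor w u :
  wtdeg w (minor_mon u) = (\sum_i w (mxvec_index (s i) (t (u i))))%N.
Proof.
rewrite /wtdeg; under eq_bigr do rewrite minor_monE big_distrr /=.
rewrite exchange_big; apply: eq_bigr => i _ /=.
rewrite (bigD1 (mxvec_index (s i) (t (u i)))) //= eqxx muln1 big1 ?addn0 // =>
  v.
by rewrite eq_sym => /negPf ->; rewrite muln0.
Qed.

Lemma wdeg_row i : wdeg (row_wt (s i)) gminor = 1%N.
Proof.
apply: wdeg_homog gminor_neq0 _ => mu /msupp_gminor[u ->].
rewrite wtdeg_minor (bigD1 i) //= row_wtE eqxx big1 // => j /negPf ji.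
by rewrite row_wtE (inj_eq s_inj) ji.
Qed.

Lemma wdeg_col j : wdeg (col_wt (pred1 (t j))) gminor = 1%N.
Proof.
apply: wdeg_homog gminor_neq0 _ => mu /msupp_gminor[u ->].
rewrite wtdeg_minor (bigD1 (u^-1 j)%g) //= col_wtE /= permKV eqxx big1 // => i.
move=> ij; rewrite col_wtE /= (inj_eq t_inj) (_ : _ == _ = false) //.
by apply: contra_neqF ij => /eqP <-; rewrite permK.
Qed.

Lemma wdeg_col_out : wdeg (col_wt (fun b => b \notin codom t)) gminor = 0%N.
Proof.
apply: wdeg_homog gminor_neq0 _ => mu /msupp_gminor[u ->].
by rewrite wtdeg_minor big1 // => i _; rewrite col_wtE codom_f.
Qed.

(** The minor has degree one in each of its rows and columns.  If a factor [b]
    avoids the row [i], then it avoids every column [t j] as well: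
    otherwise the other factor avoids it, and the entry at [s i], [t j] would
    occur in neither. *)
Lemma gminor_factor a b (i : 'I_p) :
  a * b = gminor -> wdeg (row_wt (s i)) b = 0%N -> b \is a GRing.unit.
Proof.
move=> ab bi.
have [a0 b0] : a != 0 /\ b != 0.
  by apply/andP; rewrite -negb_or -mulf_eq0 ab gminor_neq0.
have bj j : wdeg (col_wt (pred1 (t j))) b = 0%N.
  have [//|bj] := eqVneq (wdeg (col_wt (pred1 (t j))) b) 0%N.
  have aj : wdeg (col_wt (pred1 (t j))) a = 0%N.
    have := wdegM (col_wt (pred1 (t j))) a0 b0; rewrite ab wdeg_col.
    by move: bj; case: wdeg => // c _; case: wdeg => // d; rewrite addnS.
  exfalso; have : minor_mon (tperm i j) \in msupp (a * b).
    by rewrite ab mcoeff_msupp mcoeff_gminor signr_eq0.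
  case/msuppM_le/allpairsP => -[m1 m2] /= [m1a m2b] /mnmP.
  move/(_ (mxvec_index (s i) (t j))); rewrite mnmDE.
  have -> : m1 (mxvec_index (s i) (t j)) = 0%N.
    by apply: (wtdeg_eq0 (wdeg_eq0 aj m1a)); rewrite col_wtE /= eqxx.
  have -> : m2 (mxvec_index (s i) (t j)) = 0%N.
    by apply: (wtdeg_eq0 (wdeg_eq0 bi m2b)); rewrite row_wtE eqxx.
  rewrite minor_monE => /eqP; rewrite addn0 sum_nat_eq0 => /forallP/(_ i).
  by rewrite tpermL eqxx.
have bo : wdeg (col_wt (fun b => b \notin codom t)) b = 0%N.
  have := wdegM (col_wt (fun b => b \notin codom t)) a0 b0.
  by rewrite ab wdeg_col_out => /esym/eqP; rewrite addn_eq0 => /andP[_ /eqP].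
apply: mpoly_const_unit => // mu mub; apply/mnmP => v.
case/mxvec_indexP: v => x y; rewrite mnm0E.
have [/codomP[j yj]|yt] := boolP (y \in codom t).
  by apply: wtdeg_eq0 (wdeg_eq0 (bj j) mub) _; rewrite col_wtE /= yj eqxx.
by apply: wtdeg_eq0 (wdeg_eq0 bo mub) _; rewrite col_wtE yt.
Qed.

Lemma gminor_irreducible (i : 'I_p) : irreducible_elt gminor.
Proof.
split=> [||a b ab]; first exact: gminor_neq0.
  by apply/negP => /(wdeg_unit (row_wt (s i))); rewrite wdeg_row.
have [a0 b0] : a != 0 /\ b != 0.
  by apply/andP; rewrite -negb_or -mulf_eq0 -ab gminor_neq0.
have := wdegM (row_wt (s i)) a0 b0; rewrite -ab wdeg_row.
case ea: (wdeg _ a) => [|[|]] //; last first.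
  by move=> [/esym eb]; right; apply: gminor_factor eb; rewrite ab.
by move=> _; left; apply: (@gminor_factor b a i _ ea); rewrite ab mulrC.
Qed.

End GenericMinor.

(** * Gaussian elimination for functions of a matrix *)

Lemma poly_cofinite_eq0 (F : numFieldType) (P : {poly F}) a :
  (forall s, s != a -> P.[s] = 0) -> P = 0.
Proof.
move=> P0; pose r := [seq a + i.+1%:R | i <- iota 0 (size P)].
apply: (@roots_geq_poly_eq0 _ P r).
- apply/allP => _ /mapP[i _ ->]; apply/eqP/P0.
  by rewrite -subr_eq0 addrC addKr pnatr_eq0.
- rewrite map_inj_uniq ?iota_uniq // => i j /addrI/eqP.
  by rewrite eqr_nat eqSS => /eqP.
- by rewrite size_map size_iota.
Qed.

Section Triangular.

Variable F : fieldType.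

Definition upper_tri n (A : 'M[F]_n) :=
  forall i j : 'I_n, (j < i)%N -> A i j = 0.
Definition lower_tri n (A : 'M[F]_n) :=
  forall i j : 'I_n, (i < j)%N -> A i j = 0.
Definition upper_uni n (A : 'M[F]_n) := upper_tri A /\ forall i, A i i = 1.
Definition lower_uni n (A : 'M[F]_n) := lower_tri A /\ forall i, A i i = 1.

Definition is_dg p q (Z : 'M[F]_(p, q)) :=
  forall (i : 'I_p) (j : 'I_q), (i : nat) != j -> Z i j = 0.

Lemma upper_uni1 n : upper_uni (1%:M : 'M[F]_n).
Proof.
split=> [i j ji|i]; rewrite mxE ?eqxx //.
by rewrite -val_eqE /= (gtn_eqF ji) mulr0n.
Qed.

Lemma lower_uni1 n : lower_uni (1%:M : 'M[F]_n).
Proof.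
split=> [i j ij|i]; rewrite mxE ?eqxx //.
by rewrite -val_eqE /= (ltn_eqF ij) mulr0n.
Qed.

Lemma upper_uni_tr n (A : 'M[F]_n) : upper_uni A -> lower_uni A^T.
Proof.
by case=> A0 A1; split=> [i j ij|i]; rewrite mxE; [apply: A0 | apply: A1].
Qed.

Lemma lower_uni_tr n (A : 'M[F]_n) : lower_uni A -> upper_uni A^T.
Proof.
by case=> A0 A1; split=> [i j ij|i]; rewrite mxE; [apply: A0 | apply: A1].
Qed.

Lemma det_upper n (A : 'M[F]_n) : upper_tri A -> \det A = \prod_i A i i.
Proof.
move=> A0; rewrite -det_tr det_trig; last first.
  by apply/is_trig_mxP => i j ij; rewrite mxE A0.
by apply: eq_bigr => i _; rewrite mxE.
Qed.

Lemma det_lower n (A : 'M[F]_n) : lower_tri A -> \det A = \prod_i A i i.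
Proof. by move=> A0; apply: det_trig; apply/is_trig_mxP. Qed.

End Triangular.

(** A generic matrix is [L *m Z *m U] with [L] and [U] unitriangular and [Z]
    diagonal.  Here the pivots are made nonzero one at a time: the function is
    a polynomial in the pivot, and vanishes as soon as the pivot is nonzero. *)
Lemma elimination (F : numFieldType) p q (phi : 'M[F]_(p, q) -> F) :
  (p <= q)%N ->
  (forall L Z U, lower_uni L -> upper_uni U -> phi (L *m Z *m U) = phi Z) ->
  (forall (Z : 'M_(p, q)) i j,
     exists P : {poly F}, forall s, phi (Z + s *: delta_mx i j) = P.[s]) ->
  (forall Z, is_dg Z -> phi Z = 0) -> forall Z, phi Z = 0.
Proof.
move=> le_pq phiLU phi_poly phi_dg.
pose S j (Z : 'M[F]_(p, q)) := forall (a : 'I_p) (b : 'I_q),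
  (a < j)%N || (b < j)%N -> (a : nat) != b -> Z a b = 0.
suff main c Z : S (p - c)%N Z -> phi Z = 0.
  by move=> Z; apply: (main p); rewrite subnn => a b.
elim: c Z => [|c IHc] Z SZ.
  by apply: phi_dg => a b; apply: SZ; rewrite subn0 ltn_ord.
have [lt_cp|le_pc] := ltnP c p; last first.
  apply: IHc; move: SZ; have -> : (p - c.+1 = 0)%N by apply/eqP;
    rewrite subn_eq0 ltnW.
  by have -> : (p - c = 0)%N by apply/eqP; rewrite subn_eq0.
set j := (p - c.+1)%N in SZ.
have lt_jp : (j < p)%N by rewrite /j -subn_gt0 subKn.
have eSj : (p - c)%N = j.+1 by rewrite /j subnSK.
pose i0 := Ordinal lt_jp; pose j0 := Ordinal (leq_trans lt_jp le_pq).
have pivot Z' : S j Z' -> Z' i0 j0 != 0 -> phi Z' = 0.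
  move=> {}SZ z0; set z := Z' i0 j0 in z0.
  (* [L] clears the column below the pivot and [U] the row to its right. *)
  pose l (a : 'I_p) := if (j < a)%N then Z' a j0 / z else 0.
  pose u (b : 'I_q) := if (j < b)%N then Z' i0 b / z else 0.
  pose L := 1%:M - (\col_a l a) *m (delta_mx 0 i0 : 'rV_p).
  pose U := 1%:M - (delta_mx j0 0 : 'cV_q) *m (\row_b u b).
  have LE a b : L a b = (a == b)%:R - l a * (b == i0)%:R.
    by rewrite !mxE big_ord1 !mxE eqxx.
  have UE a b : U a b = (a == b)%:R - (a == j0)%:R * u b.
    by rewrite !mxE big_ord1 !mxE eqxx andbT.
  have lL : lower_uni L.
    split=> [a b ab|a]; rewrite LE ?eqxx.
      rewrite -val_eqE /= (ltn_eqF ab) mulr0n sub0r /l; case: ifP;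
        rewrite ?mul0r ?oppr0 //.
      move=> ja; case: eqP => [bi|_]; last by rewrite mulr0 oppr0.
      by move: ab; rewrite bi => /(ltn_trans ja); rewrite ltnn.
    by rewrite /l; case: eqP => [->|_]; rewrite /= ?ltnn ?mulr0 ?mul0r subr0.
  have uU : upper_uni U.
    split=> [a b ab|a]; rewrite UE ?eqxx.
      rewrite -val_eqE /= (gtn_eqF ab) mulr0n sub0r /u; case: ifP;
        rewrite ?mulr0 ?oppr0 //.
      move=> jb; case: eqP => [aj|_]; last by rewrite mul0r oppr0.
      by move: ab; rewrite aj => /(ltn_trans jb); rewrite ltnn.
    by rewrite /u; case: eqP => [->|_]; rewrite /= ?ltnn ?mulr0 ?mul0r subr0.
  rewrite -(phiLU L Z' U) //; apply: IHc; rewrite eSj => a b.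
  have -> : (L *m Z' *m U) a b =
      Z' a b - l a * Z' i0 b - (Z' a j0 - l a * z) * u b.
    have LZ : L *m Z' = \matrix_(a, b) (Z' a b - l a * Z' i0 b).
      apply/matrixP => x y; rewrite /L mulmxBl mul1mx -mulmxA -rowE !mxE
        big_ord1.
      by rewrite !mxE.
    by rewrite LZ /U mulmxBr mulmx1 mulmxA -colE !mxE big_ord1 !mxE.
  rewrite !ltnS [(a <= j)%N]leq_eqVlt [(b <= j)%N]leq_eqVlt -!orbA => ab neq.
  have lj : (a <= j)%N -> l a = 0 by rewrite /l leqNgt => /negPf ->.
  have uj : (b <= j)%N -> u b = 0 by rewrite /u leqNgt => /negPf ->.
  case/or4P: ab => [/eqP aj|aj|/eqP bj|bj].
  - have ai : a = i0 by apply: val_inj.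
    rewrite lj ?aj // !mul0r !subr0 ai -/z.
    have [lt_jb|le_bj] := ltnP j b; first by rewrite /u lt_jb mulrCA divff //
      mulr1 subrr.
    have lt_bj : (b < j)%N by rewrite ltn_neqAle le_bj andbT -aj eq_sym.
    by rewrite uj // mulr0 subr0 SZ ?lt_bj ?orbT //= -aj.
  - rewrite lj ?(ltnW aj) // !mul0r !subr0 SZ ?aj // SZ ?aj //= ?mul0r ?subr0
      //.
    by rewrite ltn_eqF.
  - have bi : b = j0 by apply: val_inj.
    rewrite uj ?bj // mulr0 subr0 bi -/z.
    have [lt_ja|le_aj] := ltnP j a; first by rewrite /l lt_ja divfK // subrr.
    have lt_aj : (a < j)%N by rewrite ltn_neqAle le_aj andbT -bj.
    by rewrite lj // mul0r subr0 SZ ?lt_aj //= -bj.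
  - rewrite uj ?(ltnW bj) // mulr0 subr0 SZ ?bj ?orbT // sub0r SZ /= ?bj ?orbT
      //.
      by rewrite mulr0 oppr0.
    by rewrite gtn_eqF.
have [P PE] := phi_poly Z i0 j0.
suff P0 : P = 0 by have := PE 0; rewrite scale0r addr0 P0 horner0.
apply: (@poly_cofinite_eq0 _ _ (- Z i0 j0)) => s sz; rewrite -PE.
apply: pivot; last by rewrite !mxE !eqxx mulr1 addrC -[X in _ + X]opprK
  subr_eq0.
move=> a b ab neq; rewrite !mxE SZ // add0r.
case: eqP => [ea|]; case: eqP => [eb|]; rewrite ?mulr0 //.
by move: neq; rewrite ea eb eqxx.
Qed.

(** * Polynomials on rectangular matrices *)

Section Model.

Variables (C : numClosedFieldType) (k m : nat).
Implicit Types (A : 'M[C]_k) (B : 'M[C]_m) (Z : 'M[C]_(k, m)).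

Local Notation D := (k * m)%N.
Local Notation Q := {mpoly C[D]}.
Implicit Types f g q : Q.

(** The map [M |-> A M B] on row vectors of matrix entries. *)
Definition sandwich A B : 'M[C]_D := lin_mx (mulmxr B \o mulmx A).

Lemma mxvec_sandwich A B Z : mxvec Z *m sandwich A B = mxvec (A *m Z *m B).
Proof. by rewrite mul_vec_lin. Qed.

Lemma sandwichE A B a b a' b' :
  sandwich A B (mxvec_index a b) (mxvec_index a' b') = A a' a * B b b'.
Proof.
rewrite /sandwich /lin_mx mxE /= vec_mx_delta mxvecE.
rewrite -(mul_delta_mx (0 : 'I_1)) mulmxA -mulmxA -colE -rowE.
by rewrite !mxE big_ord1 !mxE.
Qed.

Lemma sandwich_mulmx A B A' B' :
  sandwich A' B' *m sandwich A B = sandwich (A *m A') (B' *m B).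
Proof.
apply/row_matrixP => i; rewrite row_mul !rowE -[delta_mx 0 i]vec_mxK.
by rewrite !mxvec_sandwich !mulmxA.
Qed.

Lemma sandwich1 : sandwich 1%:M 1%:M = 1%:M.
Proof.
apply/row_matrixP => i; rewrite !rowE -[delta_mx 0 i]vec_mxK.
by rewrite mxvec_sandwich mul1mx !mulmx1.
Qed.

Lemma sandwich_tr A B : (sandwich A B)^T = sandwich A^T B^T.
Proof.
apply/matrixP => i j; case/mxvec_indexP: i => a b;
  case/mxvec_indexP: j => a' b'.
by rewrite [LHS]mxE !sandwichE !mxE.
Qed.

Lemma sandwich_ctrmx A B : ctrmx (sandwich A B) = sandwich (ctrmx A) (ctrmx B).
Proof.
apply/matrixP => i j; case/mxvec_indexP: i => a b;
  case/mxvec_indexP: j => a' b'.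
by rewrite [LHS]mxE [LHS]mxE !sandwichE !mxE rmorphM.
Qed.

Lemma sandwich_linel A A' B s :
  sandwich (A + s *: A') B = sandwich A B + s *: sandwich A' B.
Proof.
apply/matrixP => i j; case/mxvec_indexP: i => a b;
  case/mxvec_indexP: j => a' b'.
by rewrite [RHS]mxE [X in _ = _ + X]mxE !sandwichE !mxE mulrDl mulrA.
Qed.

Lemma sandwich_liner A B B' s :
  sandwich A (B + s *: B') = sandwich A B + s *: sandwich A B'.
Proof.
apply/matrixP => i j; case/mxvec_indexP: i => a b;
  case/mxvec_indexP: j => a' b'.
by rewrite [RHS]mxE [X in _ = _ + X]mxE !sandwichE !mxE mulrDr mulrCA.
Qed.

(** As a function of a matrix of variables, [rho A B f] is [f] at
    [A^T *m Z *m B^T]. *)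
Definition rho A B f : Q := msubst (sandwich A B) f.

HB.instance Definition _ A B :=
  GRing.LRMorphism.copy (rho A B) (msubst (sandwich A B)).

Lemma rho_comp A B A' B' f :
  rho A B (rho A' B' f) = rho (A *m A') (B' *m B) f.
Proof. by rewrite /rho msubst_comp sandwich_mulmx. Qed.

Lemma rho1 f : rho 1%:M 1%:M f = f.
Proof. by rewrite /rho sandwich1 msubst1. Qed.

Lemma rho_lform A B Z :
  rho A B (lform (mxvec Z)) = lform (mxvec (A *m Z *m B)).
Proof. by rewrite /rho msubst_lform mxvec_sandwich. Qed.

Lemma rho_homog A B r f : f \is r.-homog -> rho A B f \is r.-homog.
Proof. exact: msubst_homog. Qed.

Lemma fischer_rho A B f g :
  fischer (rho A B f) g = fischer f (rho (ctrmx A) (ctrmx B) g).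
Proof. by rewrite /rho fischer_msubst sandwich_ctrmx. Qed.

Definition evm f Z : C := f.@[(mxvec Z) 0].

Lemma evm_rho A B f Z : evm (rho A B f) Z = evm f (A^T *m Z *m B^T).
Proof. by rewrite /evm /rho meval_msubst sandwich_tr mxvec_sandwich. Qed.

Lemma evm_inj f g : evm f =1 evm g -> f = g.
Proof.
move=> fg; apply/eqP; rewrite -subr_eq0; apply/eqP/mpoly_eval_eq0 => z.
by rewrite mevalB -[z]vec_mxK; apply/eqP; rewrite subr_eq0; apply/eqP/fg.
Qed.

Lemma evm_line f Z Z' :
  exists P : {poly C}, forall s, evm f (Z + s *: Z') = P.[s].
Proof.
elim/mpoly_alg_ind: f => [c|i|p q [P Pp] [P' Pq]|p q [P Pp] [P' Pq]].
- by exists c%:P => s; rewrite hornerC /evm mevalC.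
- exists ((mxvec Z 0 i)%:P + (mxvec Z' 0 i) *: 'X) => s.
  by rewrite !hornerE /evm mevalXU linearD linearZ /= !mxE mulrC.
- by exists (P + P') => s; rewrite hornerD -Pp -Pq /evm mevalD.
- by exists (P * P') => s; rewrite hornerM -Pp -Pq /evm mevalM.
Qed.

(** * Leading minors *)

Hypothesis le_km : (k <= m)%N.

Definition lead_row (j : 'I_k) : 'I_j.+1 -> 'I_k := widen_ord (ltn_ord j).
Definition lead_col (j : 'I_k) : 'I_j.+1 -> 'I_m :=
  widen_ord (leq_trans (ltn_ord j) le_km).

Definition lminor (j : 'I_k) : Q := gminor C (@lead_row j) (@lead_col j).

Lemma lead_row_inj j : injective (@lead_row j).
Proof. by move=> x y /(congr1 val) /= /val_inj. Qed.

Lemma lead_col_inj j : injective (@lead_col j).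
Proof. by move=> x y /(congr1 val) /= /val_inj. Qed.

Lemma lminor_neq0 j : lminor j != 0.
Proof. by apply: gminor_neq0; [apply: lead_row_inj | apply: lead_col_inj]. Qed.

Lemma lminor_homog j : lminor j \is j.+1.-homog.
Proof. exact: gminor_homog. Qed.

Lemma lminor_irreducible j : irreducible_elt (lminor j).
Proof.
by apply: (gminor_irreducible C _ _ ord0); [apply: lead_row_inj | apply:
  lead_col_inj].
Qed.

Lemma evm_lminor j Z :
  evm (lminor j) Z = \det (mxsub (@lead_row j) (@lead_col j) Z).
Proof.
rewrite /evm /lminor /gminor -det_map_mx; congr (\det _).
by apply/matrixP => a b; rewrite !mxE /= mevalXU mxvecE.
Qed.

Lemma evm_lminor_LU j A B Z : lower_tri A -> upper_tri B ->
  evm (lminor j) (A *m Z *m B) =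
  (\prod_i A (@lead_row j i) (@lead_row j i)) *
  (\prod_i B (@lead_col j i) (@lead_col j i)) * evm (lminor j) Z.
Proof.
move=> lA uB; rewrite !evm_lminor.
have -> : mxsub (@lead_row j) (@lead_col j) (A *m Z *m B) =
    mxsub (@lead_row j) (@lead_row j) A *m mxsub (@lead_row j) (@lead_col j) Z
    *m mxsub (@lead_col j) (@lead_col j) B.
  apply/matrixP => x y; rewrite !mxE.
  rewrite (bigID (fun b : 'I_m => (b < j.+1)%N)) /= [X in _ + X]big1 ?addr0.
    rewrite (big_ord_narrow (leq_trans (ltn_ord j) le_km)).
    apply: eq_bigr => b _; rewrite !mxE; congr (_ * _).
    rewrite (bigID (fun b : 'I_k => (b < j.+1)%N)) /= [X in _ + X]big1 ?addr0.
      rewrite (big_ord_narrow (ltn_ord j)); apply: eq_bigr => a _.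
      by rewrite !mxE.
    by move=> a; rewrite -leqNgt => ja; rewrite lA ?mul0r // (leq_trans _ ja)
      //=.
  by move=> b; rewrite -leqNgt => jb; rewrite uB ?mulr0 // (leq_trans _ jb) //=.
rewrite !det_mulmx mulrAC; congr (_ * _ * _).
  by rewrite det_lower => [|x y xy]; rewrite ?mxE ?lA //;
    apply: eq_bigr => i _; rewrite mxE.
by rewrite det_upper => [|x y xy]; rewrite ?mxE ?uB //; apply: eq_bigr => i _;
  rewrite mxE.
Qed.

Definition lminor_char j A B : C :=
  (\prod_i A (@lead_row j i) (@lead_row j i)) *
  (\prod_i B (@lead_col j i) (@lead_col j i)).

Lemma rho_lminor j A B : upper_tri A -> lower_tri B ->
  rho A B (lminor j) = lminor_char j A B *: lminor j.
Proof.
move=> uA lB; apply: evm_inj => Z; rewrite evm_rho evm_lminor_LU; last 2 first.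
- by move=> a b ab; rewrite mxE uA.
- by move=> a b ab; rewrite mxE lB.
rewrite /evm mevalZ /lminor_char; congr (_ * _ * _).
  by apply: eq_bigr => a _; rewrite mxE.
by apply: eq_bigr => a _; rewrite mxE.
Qed.

Definition lmon (e : 'I_k -> nat) : Q := \prod_j lminor j ^+ e j.

Definition lmon_char (e : 'I_k -> nat) A B : C :=
  \prod_j lminor_char j A B ^+ e j.

Lemma rho_lmon e A B : upper_tri A -> lower_tri B ->
  rho A B (lmon e) = lmon_char e A B *: lmon e.
Proof.
move=> uA lB; rewrite /lmon rmorph_prod /= /lmon_char -scaler_prod.
apply: eq_bigr => j _.
by rewrite rmorphXn /= rho_lminor // exprZn.
Qed.

Lemma rho_lmon_uni e A B : upper_uni A -> lower_uni B ->
  rho A B (lmon e) = lmon e.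
Proof.
move=> [uA A1] [lB B1]; rewrite rho_lmon // /lmon_char big1 ?scale1r // => j _.
by rewrite /lminor_char !big1 ?mulr1 ?expr1n.
Qed.

Lemma lmon_neq0 e : lmon e != 0.
Proof.
by apply/prodf_neq0 => j _; rewrite expf_eq0 (negPf (lminor_neq0 j)) andbF.
Qed.

Lemma lmon_homog e : lmon e \is (\sum_(j < k) j.+1 * e j)%N.-homog.
Proof.
apply: (big_ind2 (fun (p : Q) (d : nat) => p \is d.-homog)).
- exact: dhomog1.
- by move=> p d q d'; apply: dhomogM.
- by move=> j _; apply: dhomogMn; apply: lminor_homog.
Qed.

End Model.

(** * Highest weight vectors are monomials in the leading minors *)

Lemma mul_addrow_mx (F : fieldType) p q (c : F) (x y : 'I_p)
    (M : 'M_(p, q)) i j :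
  ((1%:M + c *: delta_mx x y) *m M) i j = M i j + (i == x)%:R * c * M y j.
Proof.
rewrite mulmxDl mul1mx -scalemxAl -(mul_delta_mx (0 : 'I_1)) -mulmxA -rowE.
by rewrite !mxE big_ord1 !mxE andbT mulrA [c * _]mulrC.
Qed.

Lemma mul_addcol_mx (F : fieldType) p q (c : F) (x y : 'I_q)
    (M : 'M_(p, q)) i j :
  (M *m (1%:M + c *: delta_mx x y)) i j = M i j + M i x * c * (j == y)%:R.
Proof.
rewrite mulmxDr mulmx1 -scalemxAr -(mul_delta_mx (0 : 'I_1)) mulmxA -colE.
by rewrite !mxE big_ord1 !mxE eqxx /= mulrCA mulrA.
Qed.

Lemma tr_elem (F : fieldType) n (c : F) (x y : 'I_n) :
  (1%:M + c *: delta_mx x y)^T = 1%:M + c *: delta_mx y x.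
Proof. by rewrite linearD linearZ /= tr_scalar_mx trmx_delta. Qed.

Lemma lower_uni_elem (F : fieldType) n (c : F) (x y : 'I_n) :
  (y < x)%N -> lower_uni (1%:M + c *: delta_mx x y).
Proof.
move=> yx; split=> [i j ij|i]; rewrite !mxE ?eqxx.
  rewrite -val_eqE /= (ltn_eqF ij) mulr0n add0r.
  case: eqP => [ix|]; case: eqP => [jy|]; rewrite ?mulr0 //.
  by move: ij; rewrite ix jy ltnNge (ltnW yx).
case: eqP => [ix|]; case: eqP => [jy|]; rewrite ?mulr0 ?addr0 //.
by move: yx; rewrite -ix -jy ltnn.
Qed.

Lemma upper_uni_elem (F : fieldType) n (c : F) (x y : 'I_n) :
  (x < y)%N -> upper_uni (1%:M + c *: delta_mx x y).
Proof.
move=> xy; have := lower_uni_tr (lower_uni_elem c xy).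
by rewrite tr_elem.
Qed.

Lemma telescope_decr (f : nat -> nat) a d :
  (forall j, (f j.+1 <= f j)%N) ->
  (\sum_(a <= j < a + d) (f j - f j.+1) + f (a + d) = f a)%N.
Proof.
move=> fS; elim: d => [|d IHd]; first by rewrite addn0 big_geq.
by rewrite addnS big_nat_recr ?leq_addr //= -addnA subnK.
Qed.

Section HighestWeights.

Variables (C : numClosedFieldType) (k m : nat).
Hypothesis le_km : (k <= m)%N.
Implicit Types (A : 'M[C]_k) (B : 'M[C]_m) (Z : 'M[C]_(k, m)).

Local Notation Q := {mpoly C[k * m]}.
Local Notation lminor := (lminor C le_km).
Local Notation lmon := (@lmon C k m le_km).
Local Notation wd := (widen_ord le_km).
Implicit Types (q : Q) (e : 'I_k -> nat).

(** The [k * m] matrix with diagonal [z]. *)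
Definition dgm (z : 'rV[C]_k) : 'M[C]_(k, m) :=
  \matrix_(a, b) (z 0 a *+ ((a : nat) == b)).

Lemma is_dgE Z : is_dg Z -> Z = dgm (\row_a Z a (wd a)).
Proof.
move=> dgZ; apply/matrixP => a b; rewrite !mxE; case: eqP => [ab|/eqP ab].
  by rewrite mulr1n; congr (Z _ _); apply: val_inj.
by rewrite mulr0n dgZ.
Qed.

Lemma diag_dgm (u : 'rV[C]_k) (v : 'rV[C]_m) z :
  diag_mx u *m dgm z *m diag_mx v = dgm (\row_a (u 0 a * z 0 a * v 0 (wd a))).
Proof.
apply/matrixP => a b; rewrite mul_mx_diag mul_diag_mx !mxE.
case: eqP => [ab|_]; last by rewrite !mulr0n mulr0 mul0r.
by rewrite !mulr1n; congr (_ * v _ _); apply: val_inj.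
Qed.

Definition unipotent_fixed q :=
  forall A B, upper_uni A -> lower_uni B -> rho A B q = q.

(** The pairs [A], [D^-1] for the blocks [A], [D] of the elements of the Levi
    group, where [\det A * \det D = 1]. *)
Definition sl_pair A B := \det A = \det B /\ \det A != 0.

Definition torus_eigen q := forall u v, sl_pair (diag_mx u) (diag_mx v) ->
  exists c, rho (diag_mx u) (diag_mx v) q = c *: q.

Lemma unipotent_fixed_eq0 q :
  unipotent_fixed q -> (forall z, evm q (dgm z) = 0) -> q = 0.
Proof.
move=> qU q0; apply: evm_inj => Z; rewrite {2}/evm meval0.
apply: (elimination le_km) Z => [L Z U lL uU|Z i j|Z /is_dgE ->] //.
  rewrite -[L]trmxK -[U]trmxK -evm_rho qU //; first exact: lower_uni_tr.
  exact: upper_uni_tr.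
exact: evm_line.
Qed.

(** The exponent of the diagonal entry of index [a] in the value of a monomial
    in the leading minors at a diagonal matrix. *)
Definition tail_sum e (a : nat) : nat := (\sum_(j < k | a <= j) e j)%N.

Lemma evm_lmon_dgm e z : evm (lmon e) (dgm z) = \prod_a z 0 a ^+ tail_sum e a.
Proof.
rewrite /evm rmorph_prod /=.
under eq_bigr => j _.
  rewrite rmorphXn /= -/(evm _ _) evm_lminor det_lower; last first.
    by move=> a b ab; rewrite !mxE /= ltn_eqF.
  rewrite (_ : \prod_i _ = \prod_(a < k | (a <= j)%N) z 0 a); last first.
    rewrite (eq_bigl (fun a : 'I_k => (a < j.+1)%N)) //.
    rewrite (big_ord_narrow (ltn_ord j)); apply: eq_bigr => a _.
    by rewrite !mxE /= eqxx.
  rewrite -prodrXl big_mkcond /=; over.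
rewrite /= exchange_big; apply: eq_bigr => a _ /=.
by rewrite -big_mkcond /= prodrXr.
Qed.

(** The diagonal matrices of [tau_row a] and [tau_col a] form a torus element
    scaling the diagonal entry of index [a] by 4 and fixing the others. *)
Definition tau_row (a : 'I_k) : 'rV[C]_k := \row_i (if i == a then 2 else 1).
Definition tau_col (a : 'I_k) : 'rV[C]_m :=
  \row_i (if (i : nat) == a then 2 else 1).

Lemma sl_pair_tau a : sl_pair (diag_mx (tau_row a)) (diag_mx (tau_col a)).
Proof.
have e2 : \det (diag_mx (tau_row a)) = 2.
  rewrite det_diag (bigD1 a) //= big1 ?mxE ?eqxx ?mulr1 // => i /negPf ia.
  by rewrite mxE ia.
split; rewrite e2 ?pnatr_eq0 //.
rewrite det_diag (bigD1 (wd a)) //= big1 ?mxE ?eqxx ?mulr1 // => i.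
by rewrite -val_eqE /= => /negPf ia; rewrite mxE ia.
Qed.

Lemma tau_dgm a z : diag_mx (tau_row a) *m dgm z *m diag_mx (tau_col a) =
  dgm (\row_i (z 0 i * (if i == a then 4 else 1))).
Proof.
rewrite diag_dgm; congr dgm; apply/rowP => i; rewrite !mxE /= -val_eqE /=.
by case: eqP => _; ring.
Qed.

Lemma four_inj : injective (GRing.exp (4 : C)).
Proof. by apply: ieexprIn; rewrite ?ltr0n // pnatr_eq1. Qed.

Lemma rho_tau_lmon a e :
  rho (diag_mx (tau_row a)) (diag_mx (tau_col a)) (lmon e) =
  4 ^+ tail_sum e a *: lmon e.
Proof.
rewrite rho_lmon; last 2 first.
- by move=> i j ji; rewrite mxE -val_eqE /= (gtn_eqF ji).
- by move=> i j ji; rewrite mxE -val_eqE /= (ltn_eqF ji).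
set c := lmon_char _ _ _ _; congr (_ *: _).
have : evm (c *: lmon e) (dgm (const_mx 1)) = c.
  rewrite /evm mevalZ -/(evm _ _) evm_lmon_dgm big1 ?mulr1 // => b _.
  by rewrite mxE expr1n.
rewrite -rho_lmon; last 2 first.
- by move=> i j ji; rewrite mxE -val_eqE /= (gtn_eqF ji).
- by move=> i j ji; rewrite mxE -val_eqE /= (ltn_eqF ji).
rewrite evm_rho !tr_diag_mx tau_dgm evm_lmon_dgm => <-.
rewrite (bigD1 a) //= big1 ?mulr1 => [|b /negPf ba].
  by rewrite !mxE eqxx mul1r.
by rewrite !mxE ba mulr1 expr1n.
Qed.

Lemma tail_sum_inj e e' :
  (forall a : 'I_k, tail_sum e a = tail_sum e' a) -> e =1 e'.
Proof.
move=> ee' a.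
have tailD f : tail_sum f a = (f a + tail_sum f a.+1)%N.
  rewrite /tail_sum (bigD1 a) //=; congr (_ + _)%N; apply: eq_bigl => j.
  by rewrite ltn_neqAle -val_eqE /= andbC eq_sym.
have eS : tail_sum e a.+1 = tail_sum e' a.+1.
  have [lt_ak|le_ka] := ltnP a.+1 k; first exact: (ee' (Ordinal lt_ak)).
  by rewrite /tail_sum !big1 // => j aj; have := leq_trans (leq_trans (ltn_ord
    j) le_ka) aj; rewrite ltnn.
by have := ee' a; rewrite !tailD eS => /addIn.
Qed.

Lemma tail_sum_surj (l : 'I_k -> nat) :
  (forall a b : 'I_k, b = a.+1 :> nat -> (l b <= l a)%N) ->
  exists e, forall a : 'I_k, tail_sum e a = l a.
Proof.
move=> l_decr; (* The last exponent is [l] at the last index, hence the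
  extension by zero. *)
pose f x := if insub x is Some a then l a else 0%N.
have fE (a : 'I_k) : f a = l a by rewrite /f valK.
have f0 x : (k <= x)%N -> f x = 0%N by move=> kx;
  rewrite /f insubF // ltnNge kx.
have fS j : (f j.+1 <= f j)%N.
  have [lt_jk|/f0 -> //] := ltnP j.+1 k.
  by rewrite (fE (Ordinal lt_jk)) (fE (Ordinal (ltnW lt_jk))) l_decr.
exists (fun j => f j - f j.+1)%N => a; rewrite -fE.
rewrite -(telescope_decr a (k - a) fS) subnKC ?(ltnW (ltn_ord a)) //.
by rewrite (f0 k) // addn0 /tail_sum big_geq_mkord.
Qed.

(** Restricted to diagonal matrices, a torus eigenvector is an eigenvector of
    the scalings of single diagonal entries by 4, which separate monomials. *)
Lemma evm_dgm_monomial q : q != 0 -> unipotent_fixed q -> torus_eigen q ->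
  exists2 c, c != 0 & exists l : 'I_k -> nat,
    forall z, evm q (dgm z) = c * \prod_a z 0 a ^+ l a.
Proof.
move=> q0 qU qT.
pose X : 'M[{mpoly C[k]}]_(k, m) := \matrix_(a, b) ('X_a *+ ((a : nat) == b)).
pose P := q \mPo [tuple mxvec X 0 i | i < (k * m)].
have PE (z : 'rV_k) : P.@[z 0] = evm q (dgm z).
  rewrite /P comp_mpoly_meval; apply: meval_eq => i; rewrite tnth_mktuple.
  case/mxvec_indexP: i => a b; rewrite !mxvecE !mxE.
  by case: eqP => _; rewrite ?mulr1n ?mulr0n ?meval0 ?mevalXU.
have P0 : P != 0.
  by apply: contraNneq q0 => P0; apply/eqP/unipotent_fixed_eq0 => // z;
    rewrite -PE P0 meval0.
have Pm mu : mu \in msupp P -> mu = mlead P.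
  move=> muP; apply/mnmP => a.
  have [c cP] := qT _ _ (sl_pair_tau a).
  have Pc : msubst (diag_mx (\row_i (if i == a then 4 else 1))) P = c *: P.
    apply/eqP; rewrite -subr_eq0; apply/eqP/mpoly_eval_eq0 => z.
    rewrite mevalB meval_msubst mevalZ !PE.
    have := congr1 (fun q => evm q (dgm z)) cP.
    rewrite evm_rho !tr_diag_mx tau_dgm /evm mevalZ -!/(evm _ _) => <-.
    apply/eqP; rewrite subr_eq0; apply/eqP; congr (evm q (dgm _)).
    by rewrite mul_mx_diag; apply/rowP => i; rewrite !mxE.
  have eqc nu : nu \in msupp P -> 4 ^+ nu a = c.
    rewrite mcoeff_msupp => nuP; apply: (mulIf nuP).
    by rewrite -[RHS]mcoeffZ -Pc mcoeff_diag mchar_single.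
  by apply: four_inj; rewrite eqc // eqc ?mlead_supp.
exists (P@_(mlead P)); first by rewrite -mcoeff_msupp mlead_supp.
by exists (mlead P) => z; rewrite -PE {1}(msupp1E Pm) mevalZ mevalX.
Qed.

(** The exponents are decreasing: on the matrix that is diagonal apart from a
    block with rows [s, 1] and [-1, 0], the value is a polynomial in [s], and
    elimination gives the diagonal entries [s] and [s^-1]. *)
Lemma dgm_monomial_decr q c (l : 'I_k -> nat) :
  unipotent_fixed q -> c != 0 ->
  (forall z, evm q (dgm z) = c * \prod_a z 0 a ^+ l a) ->
  forall a b : 'I_k, b = a.+1 :> nat -> (l b <= l a)%N.
Proof.
move=> qU c0 qE a b ba; rewrite leqNgt; apply/negP => lab.
have neq_ba : b == a = false by rewrite -val_eqE /= ba gtn_eqF.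
have neq_ab : a == b = false by rewrite eq_sym.
pose w : 'rV[C]_k := \row_i (if (i == a) || (i == b) then 0 else 1).
pose Z := dgm w + delta_mx a (wd b) - delta_mx b (wd a).
have [P PE] := evm_line q Z (delta_mx a (wd a)).
pose z s : 'rV[C]_k := \row_i (if i == a then s else if i == b then s^-1 else
  1).
have qz s : evm q (dgm (z s)) = c * (s ^+ l a * s^-1 ^+ l b).
  rewrite qE (bigD1 a) //= (bigD1 b) ?neq_ba //= big1 ?mulr1; last first.
    by move=> i /andP[/negPf ia /negPf ib]; rewrite mxE ia ib expr1n.
  by rewrite !mxE eqxx neq_ba eqxx.
have PZ s : s != 0 -> P.[s] = c * (s ^+ l a * s^-1 ^+ l b).
  move=> s0; rewrite -PE -qz.
  have lt_ab : (a < b)%N by rewrite ba.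
  rewrite -[in RHS](qU (1%:M + - s^-1 *: delta_mx a b) (1%:M + s^-1 *:
    delta_mx (wd b) (wd a)));
    [|exact: upper_uni_elem|exact: lower_uni_elem].
  rewrite evm_rho !tr_elem; congr (evm q _).
  apply/matrixP => i j; rewrite mul_addcol_mx !mul_addrow_mx !mxE /=.
  rewrite -!val_eqE /= !eqxx !(eq_sym (nat_of_ord j)).
  have [ia|_] := eqVneq (i : nat) a.
    rewrite !ia [(a : nat) == b](ltn_eqF lt_ab) /= !mulr0n ?mulr1n.
    by case: (_ == _); case: (_ == _); rewrite ?mulr0n ?mulr1n; field.
  have [ib|_] := eqVneq (i : nat) b.
    rewrite !ib /= ?mulr0n ?mulr1n.
    by case: (_ == _); case: (_ == _); rewrite ?mulr0n ?mulr1n; field.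
  rewrite /= ?mulr0n ?mulr1n.
  by case: (_ == _); case: (_ == _); rewrite ?mulr0n ?mulr1n; field.
(* If [l a < l b], then [P] times a positive power of [s] is the constant [c].
  *)
pose d := (l b - l a)%N.
have d_gt0 : (0 < d)%N by rewrite subn_gt0.
have PX0 : P * 'X^d - c%:P = 0.
  apply: (@poly_cofinite_eq0 _ _ 0) => s s0; rewrite !hornerE PZ //.
  have -> : l b = (l a + d)%N by rewrite subnKC // ltnW.
  rewrite exprD !exprVn -!mulrA mulVf ?expf_neq0 // mulr1.
  by rewrite divff ?expf_neq0 // mulr1 subrr.
move/(congr1 (fun p => p.[0])): PX0; rewrite !hornerE expr0n.
by rewrite -[d]prednK //= mulr0 sub0r => /eqP; rewrite oppr_eq0 (negPf c0).
Qed.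

(** A polynomial fixed by the unipotent group is determined by its restriction
    to the diagonal matrices, where a highest weight vector is proportional to
    some monomial in the leading minors. *)
Lemma highest_weight_lmon q : q != 0 -> unipotent_fixed q -> torus_eigen q ->
  exists2 c, c != 0 & exists e, q = c *: lmon e.
Proof.
move=> q0 qU qT; have [c c0 [l qE]] := evm_dgm_monomial q0 qU qT.
exists c => //; have [e eE] := tail_sum_surj (dgm_monomial_decr qU c0 qE).
exists e; apply/eqP; rewrite -subr_eq0; apply/eqP/unipotent_fixed_eq0.
  by move=> A B uA lB; rewrite linearB linearZ /= qU // rho_lmon_uni.
move=> z; rewrite /evm mevalB mevalZ -!/(evm _ _) qE evm_lmon_dgm.
by rewrite [X in _ - c * X](eq_bigr (fun a => z 0 a ^+ l a)) ?subrr // => a _;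
  rewrite eE.
Qed.

(** * Orthogonality of the orbits of the monomials in the leading minors *)

Lemma ctrmx_upper_uni n (A : 'M[C]_n) : upper_uni A -> lower_uni (ctrmx A).
Proof.
case=> A0 A1; split=> [i j ij|i]; rewrite !mxE; first by rewrite A0 // rmorph0.
by rewrite A1 rmorph1.
Qed.

Lemma ctrmx_lower_uni n (A : 'M[C]_n) : lower_uni A -> upper_uni (ctrmx A).
Proof.
case=> A0 A1; split=> [i j ij|i]; rewrite !mxE; first by rewrite A0 // rmorph0.
by rewrite A1 rmorph1.
Qed.

Lemma ctrmx1 n : ctrmx (1%:M : 'M[C]_n) = 1%:M.
Proof. by rewrite /ctrmx map_mx1 tr_scalar_mx. Qed.

Lemma fischer_line D (K L : 'M[C]_D) (f g : {mpoly C[D]}) :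
  exists P : {poly C}, forall s, fischer (msubst (K + s *: L) f) g = P.[s].
Proof.
have [P PE] := msubst_line K L f.
exists (\poly_(i < size P) fischer P`_i g) => s.
rewrite PE horner_poly horner_coef fischer_suml; apply: eq_bigr => i _.
by rewrite -rmorphXn mulrC mul_mpolyC fischerZl mulrC.
Qed.

(** Some torus element of [tau_row] and [tau_col], which is self-adjoint, has
    different eigenvalues at the two monomials. *)
Lemma fischer_lmon e e' : ~ e =1 e' -> fischer (lmon e) (lmon e') = 0.
Proof.
move=> neq.
have [a neq_a] : exists a : 'I_k, tail_sum e a != tail_sum e' a.
  apply/existsP; rewrite -negb_forall; apply/negP => /forallP ee'.
  by apply: neq; apply: tail_sum_inj => a; apply/eqP/ee'.
have := fischer_rho (diag_mx (tau_row a)) (diag_mx (tau_col a)) (lmon e) (lmon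
  e').
have ctr n (u : 'rV[C]_n) : (forall i, u 0 i \is Num.real) -> ctrmx (diag_mx
  u) = diag_mx u.
  move=> uR; rewrite /ctrmx map_diag_mx tr_diag_mx; congr diag_mx.
  by apply/rowP => i; rewrite mxE; apply/CrealP.
rewrite !ctr; last 2 first.
- by move=> i; rewrite mxE; case: ifP; rewrite ?realn ?real1.
- by move=> i; rewrite mxE; case: ifP; rewrite ?realn ?real1.
rewrite !rho_tau_lmon fischerZl fischerZr rmorphXn rmorph_nat => /eqP.
rewrite -subr_eq0 -mulrBl mulf_eq0 subr_eq0 => /orP[/eqP/four_inj/eqP|/eqP //].
by rewrite (negPf neq_a).
Qed.

(** Matrix coefficients between two different monomials vanish: they vanish on
    pairs of diagonal matrices, and elimination reaches all other pairs. *)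
Lemma fischer_rho_lmon A B e e' :
  ~ e =1 e' -> fischer (rho A B (lmon e)) (lmon e') = 0.
Proof.
move=> neq; move: A; apply: (elimination (leqnn k)) => [L A U lL uU|A i j|A dA].
- have -> : rho (L *m A *m U) B (lmon e) = rho L 1%:M (rho A B (rho U 1%:M
    (lmon e))).
    by rewrite !rho_comp !mulmxA mul1mx mulmx1.
  rewrite (rho_lmon_uni le_km e uU (lower_uni1 _ _)) fischer_rho ctrmx1.
  by rewrite (rho_lmon_uni le_km e' (ctrmx_lower_uni lL) (lower_uni1 _ _)).
- have [P PE] := fischer_line (sandwich A B) (sandwich (delta_mx i j) B) (lmon
    e) (lmon e').
  by exists P => s; rewrite -PE /rho sandwich_linel.
move: B; apply: (elimination (leqnn m)) => [L B U lL uU|B i j|B dB].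
- have -> : rho A (L *m B *m U) (lmon e) = rho 1%:M U (rho A B (rho 1%:M L
    (lmon e))).
    by rewrite !rho_comp !mulmx1 mul1mx !mulmxA.
  rewrite (rho_lmon_uni le_km e (upper_uni1 _ _) lL) fischer_rho ctrmx1.
  by rewrite (rho_lmon_uni le_km e' (upper_uni1 _ _) (ctrmx_upper_uni uU)).
- have [P PE] := fischer_line (sandwich A B) (sandwich A (delta_mx i j)) (lmon
    e) (lmon e').
  by exists P => s; rewrite -PE /rho sandwich_liner.
rewrite rho_lmon; last 2 first.
- by move=> i j ji; rewrite dA // gtn_eqF.
- by move=> i j ij; rewrite dB // ltn_eqF.
by rewrite fischerZl fischer_lmon // mulr0.
Qed.

End HighestWeights.

(** * Existence of highest weight vectors *)

Section WeightFiltration.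

Variables (F : fieldType) (D : nat) (ht : 'I_D -> nat).
Implicit Types f g : {mpoly F[D]}.

Definition ht_ge h d f :=
  forall mu, mu \in msupp f -> (h <= wtdeg ht mu)%N /\ mdeg mu = d.

Lemma wtdegD mu nu : wtdeg ht (mu + nu)%MM = (wtdeg ht mu + wtdeg ht nu)%N.
Proof.
by rewrite /wtdeg -big_split; apply: eq_bigr => i _; rewrite mnmDE mulnDr.
Qed.

Lemma wtdegU i : wtdeg ht U_(i)%MM = ht i.
Proof.
rewrite /wtdeg (bigD1 i) //= mnm1E eqxx muln1 big1 ?addn0 // => j.
by rewrite mnm1E eq_sym => /negPf ->; rewrite muln0.
Qed.

Lemma ht_ge0 h d : ht_ge h d 0.
Proof. by move=> mu; rewrite msupp0. Qed.

Lemma ht_geD h d f g : ht_ge h d f -> ht_ge h d g -> ht_ge h d (f + g).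
Proof. by move=> fh gh mu /msuppD_le; rewrite mem_cat => /orP[/fh|/gh]. Qed.

Lemma ht_geZ h d a f : ht_ge h d f -> ht_ge h d (a *: f).
Proof. by move=> fh mu /msuppZ_le/fh. Qed.

Lemma ht_geW h h' d f : (h' <= h)%N -> ht_ge h d f -> ht_ge h' d f.
Proof. by move=> le_h fh mu /fh[hh ->]; split=> //; apply: leq_trans hh. Qed.

Lemma ht_geM h d h' d' f g :
  ht_ge h d f -> ht_ge h' d' g -> ht_ge (h + h') (d + d') (f * g).
Proof.
move=> fh gh mu /msuppM_le/allpairsP[[m1 m2] /= [/fh[h1 d1] /gh[h2 d2] ->]].
by rewrite wtdegD mdegD d1 d2; split=> //; apply: leq_add.
Qed.

Lemma ht_geX mu : ht_ge (wtdeg ht mu) (mdeg mu) 'X_[mu].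
Proof. by move=> nu; rewrite msuppX inE => /eqP ->. Qed.

Lemma ht_ge_lform h (u : 'rV[F]_D) :
  (forall j, u 0 j != 0 -> (h <= ht j)%N) -> ht_ge h 1 (lform u).
Proof.
move=> uh; rewrite /lform; apply: big_ind => [||j _].
- exact: ht_ge0.
- by move=> f g; apply: ht_geD.
have [->|/uh hj] := eqVneq (u 0 j) 0; first by rewrite scale0r; apply: ht_ge0.
apply/ht_geZ/(ht_geW hj); rewrite -(mdeg1 j) -wtdegU.
exact: ht_geX.
Qed.

(** A substitution adding only higher terms to every variable adds only higher
    terms to every polynomial. *)
Lemma ht_ge_msubst (K : 'M[F]_D) :
  (forall i, ht_ge (ht i).+1 1 (msubst K 'X_i - 'X_i)) ->
  forall h d f, (forall mu, mu \in msupp f -> wtdeg ht mu = h /\ mdeg mu = d) ->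
  ht_ge h.+1 d (msubst K f - f).
Proof.
move=> KX.
pose R mu := ht_ge (wtdeg ht mu).+1 (mdeg mu) (msubst K 'X_[mu] - 'X_[mu]).
have R0 : R 0%MM by rewrite /R mpolyX0 rmorph1 subrr; apply: ht_ge0.
have RD m1 m2 : R m1 -> R m2 -> R (m1 + m2)%MM.
  rewrite /R => h1 h2; rewrite mpolyXD rmorphM /= wtdegD mdegD.
  have -> : msubst K 'X_[m1] * msubst K 'X_[m2] - 'X_[m1] * 'X_[m2] =
    (msubst K 'X_[m1] - 'X_[m1]) * (msubst K 'X_[m2] - 'X_[m2] + 'X_[m2])
    + 'X_[m1] * (msubst K 'X_[m2] - 'X_[m2]) by ring.
  apply: ht_geD.
    rewrite -addSn; apply: ht_geM => //; apply: ht_geD; last exact: ht_geX.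
    exact: ht_geW h2.
  by rewrite -addnS; apply: ht_geM => //; apply: ht_geX.
have RX mu : R mu.
  rewrite [mu]multinomUE_id; apply: (big_ind R) => // i _.
  elim: (mu i) => [|e IHe]; first by rewrite mulm0n.
  by rewrite mulmS; apply: (RD) => //; rewrite /R wtdegU mdeg1.
move=> h d f fh; rewrite {1 2}(mpolyE f) (linear_sum (msubst K)) -sumrB big_seq.
apply: big_ind => [||mu /fh[<- <-]]; first exact: ht_ge0.
  by move=> p q; apply: ht_geD.
by rewrite (linearZ_LR (msubst K)) /= -scalerBr; apply/ht_geZ/RX.
Qed.

End WeightFiltration.

Lemma mxvec_index_eq k m (a a' : 'I_k) (b b' : 'I_m) :
  (mxvec_index a b == mxvec_index a' b') = (a == a') && (b == b').
Proof.
apply/eqP/andP => [/mxvec_index_inj[-> ->]|[/eqP -> /eqP ->] //].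
by rewrite !eqxx.
Qed.

Lemma row_subE (F : fieldType) D (K : 'M[F]_D) i j :
  (row i K - delta_mx 0 i) 0 j = K i j - (j == i)%:R.
Proof. by rewrite !mxE. Qed.

Section HighestWeightExistence.

Variables (C : numClosedFieldType) (k m : nat).
Hypotheses (le_km : (k <= m)%N) (k_gt0 : (0 < k)%N).

Local Notation Q := {mpoly C[k * m]}.

Definition stable (S : Q -> Prop) := subspace S /\
  forall (A : 'M[C]_k) (B : 'M[C]_m) q, sl_pair A B -> S q -> S (rho A B q).

(** The height of a variable is the sum of the heights of its row and column.
    The constant factors make the total heights of rows and columns equal, so
    that the powers of 2 with these exponents form an [sl_pair]. *)
Let row_ht (a : 'I_k) : nat := ((\sum_(b < m) (m - b)) * (k - a))%N.
Let col_ht (b : 'I_m) : nat := ((\sum_(a < k) (k - a)) * (m - b))%N.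
Let ht (v : 'I_(k * m)) : nat :=
  (row_ht (mxvec_pos v).1 + col_ht (mxvec_pos v).2)%N.

Let sum_ht : (\sum_a row_ht a = \sum_b col_ht b)%N.
Proof. by rewrite /row_ht /col_ht -!big_distrr /= mulnC. Qed.

Let htE a b : ht (mxvec_index a b) = (row_ht a + col_ht b)%N.
Proof. by rewrite /ht mxvec_indexK. Qed.

Let row_ht_mono (a a' : 'I_k) : (a' < a)%N -> (row_ht a < row_ht a')%N.
Proof.
move=> aa'; rewrite ltn_pmul2l ?ltn_sub2l ?(leq_trans aa') ?(ltnW (ltn_ord a))
  //.
have m_gt0 : (0 < m)%N by apply: leq_trans le_km.
by rewrite (bigD1 (Ordinal m_gt0)) //= subn0 ltn_addr.
Qed.

Let col_ht_mono (b b' : 'I_m) : (b' < b)%N -> (col_ht b < col_ht b')%N.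
Proof.
move=> bb'; rewrite ltn_pmul2l ?ltn_sub2l ?(leq_trans bb') ?(ltnW (ltn_ord b))
  //.
by rewrite (bigD1 (Ordinal k_gt0)) //= subn0 ltn_addr.
Qed.

Definition torus_row (u : 'rV[C]_k) (v : 'rV[C]_m) : 'rV[C]_(k * m) :=
  mxvec (\matrix_(a, b) (u 0 a * v 0 b)).

Lemma sandwich_diag u v :
  sandwich (diag_mx u) (diag_mx v) = diag_mx (torus_row u v).
Proof.
apply/matrixP => i j; case/mxvec_indexP: i => a b;
  case/mxvec_indexP: j => a' b'.
rewrite sandwichE [RHS]mxE /torus_row mxvecE !mxE mxvec_index_eq [a' ==
  a]eq_sym.
case: (a =P a') => [->|_]; last by rewrite mulr0n mul0r.
by case: (b =P b') => [->|_]; rewrite ?mulr1n ?mulr0n ?mulr0.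
Qed.

(** The height of a variable grows when its row or column index decreases, so
    that unipotent elements raise it, and it is the exponent of a one-parameter
    subgroup of the torus, so that torus eigenvectors are homogeneous for it. *)
Lemma torus_vector_ht (S : Q -> Prop) q : stable S -> S q -> q != 0 ->
  exists g h d, [/\ S g, g != 0, {subset msupp g <= msupp q}, torus_eigen g &
    forall mu, mu \in msupp g -> wtdeg ht mu = h /\ mdeg mu = d].
Proof.
move=> [subS stS] Sq q0.
pose T t := exists u v, sl_pair (diag_mx u) (diag_mx v) /\ t = torus_row u v.
have [|g [Sg g0 gq gT]] := torus_vector (T := T) subS _ Sq q0.
  move=> _ g [u [v [uv ->]]] Sg; rewrite -sandwich_diag; exact: stS.
exists g, (wtdeg ht (mlead g)), (mdeg (mlead g)); split=> //.
  move=> u v uv; exists (mchar (torus_row u v) (mlead g)).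
  apply/mpolyP => mu; rewrite /rho sandwich_diag mcoeff_diag mcoeffZ.
  have [mug|/memN_msupp_eq0 ->] := boolP (mu \in msupp g);
    last by rewrite !mulr0.
  by rewrite (gT _ mu (mlead g)) ?mlead_supp //; exists u, v.
have two_neq0 n : (2 : C) ^+ n != 0 by rewrite expf_neq0 // pnatr_eq0.
move=> mu mug; split.
  pose u : 'rV[C]_k := \row_a 2 ^+ row_ht a.
  pose v : 'rV[C]_m := \row_b 2 ^+ col_ht b.
  have charE nu : mchar (torus_row u v) nu = 2 ^+ wtdeg ht nu.
    rewrite /mchar /wtdeg -prodrXr; apply: eq_bigr => i _.
    case/mxvec_indexP: i => a b.
    by rewrite /torus_row mxvecE !mxE -exprD htE exprM.
  apply: (@expr2_inj C); rewrite -!charE; apply: gT => //;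
    last exact: mlead_supp.
  exists u, v; split=> //; rewrite /sl_pair !det_diag.
  do 2?under eq_bigr do rewrite mxE.
  rewrite prodrXr; split=> //; under [RHS]eq_bigr do rewrite mxE.
  by rewrite prodrXr sum_ht.
(* Scalar blocks, of equal determinants, read off the degree. *)
pose u : 'rV[C]_k := const_mx (2 ^+ m).
pose v : 'rV[C]_m := const_mx (2 ^+ k).
have charE nu : mchar (torus_row u v) nu = (2 ^+ (m + k)) ^+ mdeg nu.
  rewrite /mchar mdegE -prodrXr; apply: eq_bigr => i _.
  by case/mxvec_indexP: i => a b; rewrite /torus_row mxvecE !mxE -exprD.
have mk_gt0 : (0 < m + k)%N by rewrite addn_gt0 k_gt0 orbT.
have : (2 : C) ^+ ((m + k) * mdeg mu) = 2 ^+ ((m + k) * mdeg (mlead g)).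
  rewrite !exprM -!charE; apply: gT => //; last exact: mlead_supp.
  exists u, v; split=> //; rewrite /sl_pair !det_diag.
  rewrite (eq_bigr (fun=> 2 ^+ m)) => [|i _]; last by rewrite mxE.
  rewrite [X in _ = X](eq_bigr (fun=> 2 ^+ k)) => [|i _]; last by rewrite mxE.
  by rewrite !prodr_const !card_ord -!exprM mulnC.
by move/expr2_inj/eqP; rewrite eqn_pmul2l // => /eqP.
Qed.

Lemma rho_raise (A : 'M[C]_k) (B : 'M[C]_m) i : upper_uni A -> lower_uni B ->
  ht_ge ht (ht i).+1 1 (rho A B 'X_i - 'X_i).
Proof.
move=> [uA A1] [lB B1]; rewrite /rho msubstXU -lform_delta -linearB /=.
apply: ht_ge_lform => j; rewrite row_subE.
case/mxvec_indexP: i => a b; case/mxvec_indexP: j => a' b'.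
rewrite sandwichE !htE mxvec_index_eq -!val_eqE /=.
have [lt_aa'|lt_a'a|eq_a] := ltngtP a a'.
- by rewrite uA // mul0r subr0 eqxx.
- rewrite subr0 => nz; have le_b'b : (b' <= b)%N.
    by rewrite leqNgt; apply: contraNN nz => lt_bb'; rewrite lB // mulr0.
  rewrite -addSn leq_add ?row_ht_mono //.
  by move: le_b'b; rewrite leq_eqVlt => /orP[/eqP/val_inj ->
    //|/col_ht_mono/ltnW].
have -> : a' = a by apply/esym/val_inj.
rewrite A1 mul1r; have [lt_bb'|lt_b'b|eq_b] := ltngtP b b'.
- by rewrite lB // subr0 eqxx.
- by move=> _; rewrite -addnS leq_add // col_ht_mono.
have -> : b' = b by apply/esym/val_inj.
by rewrite B1 subrr eqxx.
Qed.

Lemma det_upper_uni n (A : 'M[C]_n) : upper_uni A -> \det A = 1.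
Proof. by case=> uA A1; rewrite det_upper // big1. Qed.

Lemma det_lower_uni n (A : 'M[C]_n) : lower_uni A -> \det A = 1.
Proof. by case=> lA A1; rewrite det_lower // big1. Qed.

(** Heights are bounded in terms of the degree, so a torus eigenvector of
    maximal height exists, and unipotent elements can only fix it. *)
Lemma exists_highest_weight (S : Q -> Prop) : stable S -> nonzero S ->
  exists q, [/\ S q, q != 0, unipotent_fixed q & torus_eigen q].
Proof.
move=> stS [q0 Sq0 nz0]; have [q [h [d [Sq nz _ qT qh]]]] := torus_vector_ht
  stS Sq0 nz0.
pose M := (\sum_v ht v)%N.
have htM (mu : 'X_{1..k * m}) : (wtdeg ht mu <= M * mdeg mu)%N.
  rewrite mdegE big_distrr; apply: leq_sum => v _; rewrite leq_mul2r.
  by rewrite /M (bigD1 v) //= leq_addr orbT.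
have [n] := ubnP (M * d - h); elim: n q h Sq nz qT qh =>
  // n IHn q h Sq nz qT qh lt_n.
case: (classic (unipotent_fixed q)) => [qU|nU]; first by exists q.
have [A [B [uA lB /eqP neq]]] : exists (A : 'M[C]_k) (B : 'M[C]_m),
    [/\ upper_uni A, lower_uni B & rho A B q <> q].
  apply: NNPP => no; apply: nU => A B uA lB; apply: NNPP => neq.
  by apply: no; exists A, B.
have Sg : S (rho A B q - q).
  apply: (subspaceB stS.1) => //; apply: stS.2 => //.
  by rewrite /sl_pair det_upper_uni // det_lower_uni // oner_eq0.
rewrite -subr_eq0 in neq.
have gh : ht_ge ht h.+1 d (rho A B q - q).
  by apply: ht_ge_msubst => // i; apply: rho_raise.
have [g [h' [d' [Sg' nz' gq gT gh']]]] := torus_vector_ht stS Sg neq.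
have [le_h' le_d'] : (h < h')%N /\ d' = d.
  by have /gh'[<- <-] := mlead_supp nz'; have /gq/gh := mlead_supp nz'.
apply: (IHn g h') => //; first by rewrite -le_d'.
rewrite -ltnS; apply: leq_trans lt_n; rewrite ltnS ltn_sub2l //.
apply: leq_trans le_h' _; rewrite -le_d'.
by have /gh'[<- <-] := mlead_supp nz'; apply: htM.
Qed.

Corollary exists_lmon (S : Q -> Prop) : stable S -> nonzero S ->
  exists e, S (lmon C le_km e).
Proof.
move=> stS /(exists_highest_weight stS)[q [Sq nz qU qT]].
have [c c0 [e qE]] := highest_weight_lmon le_km nz qU qT; exists e.
have -> : lmon C le_km e = c^-1 *: q by rewrite qE scalerA mulVf // scale1r.
exact: (subspaceZ stS.1).
Qed.

End HighestWeightExistence.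

(** * The decomposition of the polynomials on matrices *)

Section Decomposition.

Variables (C : numClosedFieldType) (k m : nat).
Hypotheses (le_km : (k <= m)%N) (k_gt0 : (0 < k)%N).

Local Notation Q := {mpoly C[k * m]}.
Local Notation lmon := (@lmon C k m le_km).
Implicit Types (q : Q) (e : 'I_k -> nat) (A : 'M[C]_k) (B : 'M[C]_m).

(** The span is taken as the intersection of the subspaces containing the
    orbit. *)
Definition orbit_span e q := forall S : Q -> Prop, subspace S ->
  (forall A B, sl_pair A B -> S (rho A B (lmon e))) -> S q.

Lemma sl_pair1 : sl_pair (1%:M : 'M[C]_k) (1%:M : 'M[C]_m).
Proof. by rewrite /sl_pair !det1 oner_eq0. Qed.

Lemma sl_pairM A B A' B' :
  sl_pair A B -> sl_pair A' B' -> sl_pair (A *m A') (B' *m B).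
Proof.
by move=> [eAB A0] [eAB' A0']; rewrite /sl_pair !det_mulmx -eAB -eAB' mulrC
  mulf_neq0.
Qed.

Lemma sl_pair_ctrmx A B : sl_pair A B -> sl_pair (ctrmx A) (ctrmx B).
Proof.
by move=> [eAB A0]; rewrite /sl_pair /ctrmx !det_tr !det_map_mx -eAB fmorph_eq0.
Qed.

Lemma orbit_span_stable e : stable (orbit_span e).
Proof.
split=> [|A B q AB qe S subS Sorb].
  split=> [|a u v ue ve] S subS Sorb; first exact: subS.1.
  by apply: subS.2; [apply: ue | apply: ve].
apply: (qe (fun q => S (rho A B q))) => [|A' B' AB'].
  split=> [|a u v Su Sv]; first by rewrite raddf0; apply: subS.1.
  by rewrite linearP; apply: subS.2.
by rewrite rho_comp; apply/Sorb/sl_pairM.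
Qed.

Lemma orbit_span_lmon e : orbit_span e (lmon e).
Proof. by move=> S _ Sorb; rewrite -[lmon e]rho1; apply/Sorb/sl_pair1. Qed.

Lemma orbit_span_min e (S : Q -> Prop) :
  stable S -> S (lmon e) -> forall q, orbit_span e q -> S q.
Proof. by move=> [subS stS] Se q qe; apply: (qe S) => // A B AB;
  apply: stS. Qed.

Lemma homog_stable r : stable (fun q => q \is r.-homog).
Proof.
split=> [|A B q _]; last exact: rho_homog.
by split=> [|a u v ur vr]; [apply: rpred0 | rewrite rpredD ?rpredZ].
Qed.

Lemma orbit_span_homog e q :
  orbit_span e q -> q \is (\sum_(j < k) j.+1 * e j)%N.-homog.
Proof.
apply: (@orbit_span_min e (fun q => q \is _.-homog)); last exact: lmon_homog.
exact: homog_stable.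
Qed.

(** The set of pairs acting is closed under conjugate transposes. *)
Lemma orthogonal_stable (S : Q -> Prop) :
  (forall A B q, sl_pair A B -> S q -> S (rho A B q)) ->
  stable (fun q => forall w, S w -> fischer q w = 0).
Proof.
move=> stS; split=> [|A B q AB qS w Sw].
  split=> [w _|a u v uS vS w Sw]; first exact: fischer0l.
  by rewrite fischer_linear uS // vS // mulr0 addr0.
by rewrite fischer_rho qS //; apply: stS => //; apply: sl_pair_ctrmx.
Qed.

Lemma orbit_span_orth e e' q q' : ~ e =1 e' ->
  orbit_span e q -> orbit_span e' q' -> fischer q q' = 0.
Proof.
move=> neq qe q'e'.
have orth1 w : orbit_span e w -> fischer w (lmon e') = 0.
  move=> we; apply: (we (fun f => fischer f (lmon e') = 0)) => [|A B AB];
    last exact: fischer_rho_lmon.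
  split=> [|a u v uS vS]; first exact: fischer0l.
  by rewrite fischer_linear uS vS mulr0 addr0.
have := @orthogonal_stable (orbit_span e) (orbit_span_stable e).2.
move/(@orbit_span_min e'); rewrite fischerC => -> //; first by rewrite rmorph0.
by move=> w we; rewrite fischerC orth1 ?rmorph0.
Qed.

(** A nonzero stable subspace of the orbit span contains a monomial in the
    minors, which by orthogonality can only be the given one. *)
Lemma orbit_span_irreducible e (S : Q -> Prop) :
  stable S -> (forall q, S q -> orbit_span e q) -> nonzero S ->
  forall q, orbit_span e q -> S q.
Proof.
move=> stS Se nzS; have [e' Se'] := exists_lmon le_km k_gt0 stS nzS.
case: (classic (e =1 e')) => [ee'|neq].
  apply: orbit_span_min => //; suff -> : lmon e = lmon e' by [].
  by apply: eq_bigr => j _; rewrite ee'.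
have := orbit_span_orth neq (Se _ Se') (orbit_span_lmon (e := e')).
by move/fischer_eq0/eqP; rewrite (negPf (lmon_neq0 _ _ _)).
Qed.

Section Degree.

Variable r : nat.

Local Notation I := {ffun 'I_k -> 'I_r.+1}.
Local Notation idx := (fun i : I => (\sum_(j < k) j.+1 * i j)%N == r).
Local Notation expo i := (fun j : 'I_k => nat_of_ord ((i : I) j)).

Lemma expo_inj (i i' : I) : expo i =1 expo i' -> i = i'.
Proof. by move=> ii'; apply/ffunP => j; apply/val_inj/ii'. Qed.

Lemma homog_supp (q : Q) : q \is r.-homog ->
  {subset msupp q <= [seq bmnm mu | mu : 'X_{1..(k * m) < r.+1}]}.
Proof.
move=> /dhomogP qr mu muq; have lt_mu : (mdeg mu < r.+1)%N by rewrite (qr _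
  muq).
by apply/mapP; exists (BMultinom lt_mu); rewrite ?mem_enum.
Qed.

(** The orthogonal complement of the sum of the orbit spans is stable, so it
    would contain a monomial in the minors if it were nonzero. *)
Lemma homog_decomposition q : q \is r.-homog ->
  exists2 w : I -> Q, (forall i, idx i -> orbit_span (expo i) (w i)) &
    q = \sum_(i | idx i) w i.
Proof.
move=> qr; pose M f := exists2 w : I -> Q,
  (forall i, idx i -> orbit_span (expo i) (w i)) & f = \sum_(i | idx i) w i.
have subM : subspace M.
  split=> [|a u v [wu uM ->] [wv vM ->]].
    by exists (fun=> 0) => [i _|]; [apply: (orbit_span_stable _).1.1 | rewrite
      big1].
  exists (fun i => a *: wu i + wv i) => [i ir|].
    by apply: (orbit_span_stable _).1.2; [apply: uM | apply: vM].
  by rewrite big_split scaler_sumr.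
have stM A B f : sl_pair A B -> M f -> M (rho A B f).
  move=> AB [w wM ->]; exists (fun i => rho A B (w i)) => [i ir|].
    by apply: (orbit_span_stable _).2 => //; apply: wM.
  by rewrite (linear_sum (rho A B)).
have Mr f : M f -> f \is r.-homog.
  move=> [w wM ->]; apply: rpred_sum => i ir.
  by have := orbit_span_homog (wM _ ir); rewrite (eqP ir).
have Mlmon (i : I) : idx i -> M (lmon (expo i)).
  move=> ir; exists (fun i' => if i' == i then lmon (expo i) else 0) => [i' _|].
    case: eqP => [->|_]; first exact: orbit_span_lmon.
    exact: (orbit_span_stable _).1.1.
  by rewrite (bigD1 i) //= eqxx big1 ?addr0 // => i' /andP[_ /negPf ->].
have [u Mu uP] := fischer_proj subM (fun f Mf => homog_supp (Mr f Mf)) q.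
suff -> : q = u by [].
apply/eqP; rewrite -subr_eq0; apply/negPn/negP => nz.
pose N f := f \is r.-homog /\ forall w, M w -> fischer f w = 0.
have stN : stable N.
  have [sub1 st1] := homog_stable r; have [sub2 st2] := orthogonal_stable stM.
  split=> [|A B f AB [f1 f2]]; last by split; [apply: st1 | apply: st2].
  split=> [|a f g [f1 f2] [g1 g2]]; first by split;
    [apply: sub1.1 | apply: sub2.1].
  by split; [apply: sub1.2 | apply: sub2.2].
have [|e [er eM]] := exists_lmon le_km k_gt0 stN.
  exists (q - u); last exact: nz.
  by split; [apply: rpredB => //; apply: Mr | apply: uP].
have sum_e : (\sum_(j < k) j.+1 * e j)%N = r.
  by apply: dhomog_uniq er; [apply: lmon_neq0 | apply: lmon_homog].
have le_er j : (e j < r.+1)%N.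
  by rewrite ltnS -sum_e (bigD1 j) //= mulSn -addnA leq_addr.
pose i : I := [ffun j => Ordinal (le_er j)].
have ie : expo i =1 e by move=> j; rewrite ffunE.
have lmon_ie : lmon (expo i) = lmon e by apply: eq_bigr => j _; rewrite ie.
have /fischer_eq0/eqP : fischer (lmon e) (lmon e) = 0.
  apply: eM; rewrite -lmon_ie; apply: Mlmon.
  by rewrite -[X in _ == X]sum_e; apply/eqP/eq_bigr => j _; rewrite ie.
by rewrite (negPf (lmon_neq0 _ _ _)).
Qed.

Lemma homog_decomposition_uniq (w : I -> Q) :
  (forall i, idx i -> orbit_span (expo i) (w i)) ->
  \sum_(i | idx i) w i = 0 -> forall i, idx i -> w i = 0.
Proof.
move=> wE w0 i ir; apply: fischer_eq0.
have <- : fischer (\sum_(i | idx i) w i) (w i) = fischer (w i) (w i).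
  rewrite fischer_suml (bigD1 i) //= big1 ?addr0 // => i' /andP[ir' neq].
  apply: orbit_span_orth (wE _ ir') (wE _ ir) => ii'.
  by rewrite (expo_inj ii') eqxx in neq.
by rewrite w0 fischer0l.
Qed.

End Degree.

End Decomposition.

(** * The action of the parabolic group *)

Lemma lower_uni_inv (F : fieldType) n (X Y : 'M[F]_n) :
  lower_uni X -> X *m Y = 1%:M -> lower_uni Y.
Proof.
move=> [lX X1] XY.
have YE (i j : 'I_n) : (forall l : 'I_n, (l < i)%N -> Y l j = 0) ->
    Y i j = (i == j)%:R.
  move=> Y0; have := congr1 (fun M : 'M_n => M i j) XY; rewrite !mxE => <-.
  rewrite (bigD1 i) //= X1 mul1r big1 ?addr0 // => l.
  rewrite -val_eqE /=; case: ltngtP => // [/Y0 ->|/lX ->] _;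
    first by rewrite mulr0.
  by rewrite mul0r.
have Y0 (i j : 'I_n) : (i < j)%N -> Y i j = 0.
  have [d] := ubnP i; elim: d i j => // d IHd i j lt_d lt_ij; rewrite YE.
    by rewrite -val_eqE /= (ltn_eqF lt_ij).
  move=> l lt_li; apply: IHd; last exact: ltn_trans lt_ij.
  exact: leq_trans lt_li lt_d.
by split=> // i; rewrite YE ?eqxx // => l; apply: Y0.
Qed.

Lemma det_sandwich_tr (F : fieldType) N1 N2
    (P : 'M[F]_(N1, N2)) (g : 'M[F]_N2) :
  N1 = N2 -> P *m P^T = 1%:M -> \det (P *m g *m P^T) = \det g.
Proof.
move=> e; case: _ / e in P g * => PP.
by rewrite !det_mulmx mulrAC -det_mulmx PP det1 mul1r.
Qed.

Section Blocks.

Variables (C : numClosedFieldType) (n k : nat).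
Hypotheses (k_gt0 : (0 < k)%N) (k_le : (k <= n.+1 - k)%N).

Local Notation N := n.+1.
Local Notation m := (n.+1 - k)%N.
Implicit Types (g t u : 'M[C]_N) (A : 'M[C]_k) (B D : 'M[C]_m).

Let le_kN : (k <= N)%N := leq_trans k_le (leq_subr k N).
Let le_mN : (m <= N)%N := leq_subr k N.

Definition top_idx (a : 'I_k) : 'I_N := widen_ord le_kN a.

(** The lower block is read from its last row and column, so that the minors
    fixed by the unipotent group become leading ones. *)
Definition bot_idx (b : 'I_m) : 'I_N := rev_ord (widen_ord le_mN b).

Definition block_idx (s : 'I_k + 'I_m) : 'I_N :=
  match s with inl a => top_idx a | inr b => bot_idx b end.

Lemma top_idx_lt a : (top_idx a < k)%N. Proof. exact: (ltn_ord a). Qed.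

Lemma bot_idx_ge b : (k <= bot_idx b)%N.
Proof.
have := ltn_ord b; rewrite /= subSS => lt_bm; rewrite -(leq_add2r b) subnK;
  last first.
  by rewrite -ltnS (leq_trans lt_bm).
by rewrite -ltnS -addnS -leq_subRL ?(leq_trans k_le) // leq_subr.
Qed.

Lemma top_idx_inj : injective top_idx.
Proof. by move=> x y /(congr1 val) /= /val_inj. Qed.

Lemma bot_idx_inj : injective bot_idx.
Proof. by move=> x y /rev_ord_inj/(congr1 val) /= /val_inj. Qed.

Lemma bot_idx_lt b b' : (bot_idx b < bot_idx b')%N = (b' < b)%N.
Proof.
rewrite /= !subSS ltn_sub2lE // -ltnS.
by apply: leq_trans (ltn_ord b) le_mN.
Qed.

Lemma top_bot a b : (top_idx a == bot_idx b) = false.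
Proof. by rewrite -val_eqE /= ltn_eqF // (leq_trans (top_idx_lt a) (bot_idx_ge
  b)). Qed.

Arguments top_idx : simpl never.
Arguments bot_idx : simpl never.

Lemma block_idx_bij : bijective block_idx.
Proof.
apply: inj_card_bij; last by rewrite card_sum !card_ord subnKC.
case=> [a|b] [a'|b'] /= e.
- by rewrite (top_idx_inj e).
- by have := top_bot a b'; rewrite e eqxx.
- by have := top_bot a' b; rewrite e eqxx.
- by rewrite (bot_idx_inj e).
Qed.

Lemma block_idxP i : exists s, i = block_idx s.
Proof. by have [f _ fK] := block_idx_bij; exists (f i); rewrite fK. Qed.

Definition ul g : 'M[C]_k := mxsub top_idx top_idx g.
Definition ur g : 'M[C]_(k, m) := mxsub top_idx bot_idx g.
Definition ll g : 'M[C]_(m, k) := mxsub bot_idx top_idx g.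
Definition lr g : 'M[C]_m := mxsub bot_idx bot_idx g.

Lemma mxsub_mulmx p q (r : 'I_p -> 'I_N) (c : 'I_q -> 'I_N) g t :
  mxsub r c (g *m t) = mxsub r top_idx g *m mxsub top_idx c t
                     + mxsub r bot_idx g *m mxsub bot_idx c t.
Proof.
apply/matrixP => i j; rewrite !mxE (reindex block_idx) /=; last first.
  by apply: onW_bij; apply: block_idx_bij.
by rewrite big_sumType /=; congr (_ + _); apply: eq_bigr => x _; rewrite !mxE.
Qed.

Lemma ul1 : ul 1%:M = 1%:M.
Proof. by apply/matrixP => a b; rewrite !mxE (inj_eq top_idx_inj). Qed.
Lemma lr1 : lr 1%:M = 1%:M.
Proof. by apply/matrixP => a b; rewrite !mxE (inj_eq bot_idx_inj). Qed.
Lemma ur1 : ur 1%:M = 0.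
Proof. by apply/matrixP => a b; rewrite !mxE top_bot. Qed.
Lemma ll1 : ll 1%:M = 0.
Proof. by apply/matrixP => a b; rewrite !mxE eq_sym top_bot. Qed.

(** Conjugation by the permutation that lists the upper block and then the
    reversed lower block makes [g] lower block triangular. *)
Lemma det_blocks g : ur g = 0 -> \det g = \det (ul g) * \det (lr g).
Proof.
move=> ur0; pose P : 'M[C]_(k + m, N) :=
  col_mx (rowsub top_idx 1%:M) (rowsub bot_idx 1%:M).
have PE (X : 'M_N) : P *m X *m P^T = block_mx (ul X) (ur X) (ll X) (lr X).
  rewrite /P mul_col_mx tr_col_mx mul_col_row !mul_rowsub_mx !mul1mx.
  rewrite !trmx_mxsub tr_scalar_mx !mulmx_colsub !mulmx1.
  by congr block_mx; apply/matrixP => x y; rewrite !mxE.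
have PP : P *m P^T = 1%:M.
  by rewrite -{1}[P]mulmx1 PE ul1 ur1 ll1 lr1 -scalar_mx_block.
by rewrite -(det_sandwich_tr g _ PP) ?subnKC // PE ur0 det_lblock.
Qed.

Lemma ur_eq0 g : ur g = 0 <-> forall i j : 'I_N, (i < k <= j)%N -> g i j = 0.
Proof.
split=> [g0 i j|g0].
  have [[a|b] ->] := block_idxP i; last first.
    by rewrite /= ltnNge (bot_idx_ge b).
  have [[a'|b] ->] := block_idxP j.
    by rewrite /= [(k <= _)%N]leqNgt !top_idx_lt.
  by move=> _; have /matrixP/(_ a b) := g0; rewrite !mxE.
apply/matrixP => a b; rewrite !mxE; apply: g0.
by apply/andP; split; [apply: top_idx_lt | apply: bot_idx_ge].
Qed.

Lemma parabolic_ur g : parabolic k g <-> \det g = 1 /\ ur g = 0.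
Proof. by split=> -[g1 /ur_eq0 g0]. Qed.

Lemma levi_ll g : levi k g <-> [/\ \det g = 1, ur g = 0 & ll g = 0].
Proof.
split=> [[g1 g0]|[g1 ur0 ll0]].
  have lt_top a : (top_idx a < k)%N = true by apply: top_idx_lt.
  have ge_bot b : (bot_idx b < k)%N = false by rewrite ltnNge bot_idx_ge.
  by split=> //; apply/matrixP => x y; rewrite !mxE; apply: g0;
    rewrite lt_top ge_bot.
split=> // i j.
have [[a|b] ->] := block_idxP i; have [[a'|b'] ->] := block_idxP j => /=.
- by rewrite !top_idx_lt.
- by move=> _; have /matrixP/(_ a b') := ur0; rewrite !mxE.
- by move=> _; have /matrixP/(_ b a') := ll0; rewrite !mxE.
- by rewrite ![(_ < k)%N]ltnNge !bot_idx_ge.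
Qed.

Lemma levi_parabolic g : levi k g -> parabolic k g.
Proof. by move=> /levi_ll[g1 ur0 _]; apply/parabolic_ur. Qed.

Section ParabolicElement.

Variable g : 'M[C]_N.
Hypothesis g_par : parabolic k g.

Let g_unit : g \in unitmx.
Proof. by case: g_par => g1 _; rewrite unitmxE g1 unitr1. Qed.

Let urg : ur g = 0. Proof. by case/parabolic_ur: g_par. Qed.

Lemma ul_inv : ul g *m ul (invmx g) = 1%:M.
Proof.
have : ul (g *m invmx g) = ul g *m ul (invmx g) + ur g *m ll (invmx g).
  exact: mxsub_mulmx.
by rewrite mulmxV // ul1 urg mul0mx addr0.
Qed.

Lemma ur_inv : ur (invmx g) = 0.
Proof.
have : ur (g *m invmx g) = ul g *m ur (invmx g) + ur g *m lr (invmx g).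
  exact: mxsub_mulmx.
rewrite mulmxV // ur1 urg mul0mx addr0 => /esym ulur.
have [ulu _] := mulmx1_unit ul_inv.
by rewrite -[ur _]mul1mx -(mulVmx ulu) -mulmxA ulur mulmx0.
Qed.

Lemma lr_inv : lr g *m lr (invmx g) = 1%:M.
Proof.
have : lr (g *m invmx g) = ll g *m ur (invmx g) + lr g *m lr (invmx g).
  exact: mxsub_mulmx.
by rewrite mulmxV // lr1 ur_inv mulmx0 add0r.
Qed.

Lemma parabolic_sl_pair : sl_pair (ul g) (lr (invmx g)).
Proof.
have [g1 _] := g_par; move: g1; rewrite det_blocks // => g1.
have := congr1 determinant lr_inv; rewrite det_mulmx det1 => lr1.
have ul0 : \det (ul g) != 0.
  by apply: contra_eq_neq g1 => ->; rewrite mul0r eq_sym oner_eq0.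
split=> //; have lr0 : \det (lr g) != 0.
  by apply: contra_eq_neq g1 => ->; rewrite mulr0 eq_sym oner_eq0.
by apply: (mulIf lr0); rewrite g1 mulrC lr1.
Qed.

Lemma ur_adjoint X : ur (adjoint g X) = ul g *m ur X *m lr (invmx g).
Proof.
have mulE (Y Z : 'M_N) : ur (Y *m Z) = ul Y *m ur Z + ur Y *m lr Z.
  exact: mxsub_mulmx.
by rewrite /adjoint !mulE ur_inv mulmx0 add0r urg mul0mx addr0.
Qed.

End ParabolicElement.

Lemma levi_lift A D B : D *m B = 1%:M -> sl_pair A B ->
  exists g, [/\ levi k g, ul g = A, lr g = D & lr (invmx g) = B].
Proof.
move=> DB [eAB A0]; have [f fK _] := block_idx_bij.
pose g : 'M[C]_N := \matrix_(i, j)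
  match f i, f j with
  | inl a, inl a' => A a a'
  | inr b, inr b' => D b b'
  | _, _ => 0
  end.
have fa a : f (top_idx a) = inl a by rewrite -[top_idx a]/(block_idx (inl a))
  fK.
have fb b : f (bot_idx b) = inr b by rewrite -[bot_idx b]/(block_idx (inr b))
  fK.
have ulg : ul g = A by apply/matrixP => x y; rewrite !mxE !fa.
have lrg : lr g = D by apply/matrixP => x y; rewrite !mxE !fb.
have urg : ur g = 0 by apply/matrixP => x y; rewrite !mxE fa fb.
have llg : ll g = 0 by apply/matrixP => x y; rewrite !mxE fa fb.
have g1 : \det g = 1.
  by rewrite det_blocks // ulg lrg eAB mulrC -det_mulmx DB det1.
have lg : levi k g by apply/levi_ll.
exists g; split=> //; have := lr_inv (levi_parabolic lg); rewrite lrg => DB'.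
have [Du _] := mulmx1_unit DB.
by apply: (can_inj (mulKmx Du)); rewrite DB DB'.
Qed.

Lemma levi_lift_pair A B : sl_pair A B ->
  exists g, [/\ levi k g, ul g = A & lr (invmx g) = B].
Proof.
move=> AB; have [eAB A0] := AB.
have Bu : B \in unitmx by rewrite unitmxE unitfE -eAB.
by have [g [? ? _ ?]] := levi_lift (mulVmx Bu) AB; exists g.
Qed.

(** The group acts through its two diagonal blocks, as the upper right block of
    [g X g^-1] is the product of the upper left block of [g], the upper right
    block of [X] and the lower right block of [g^-1]. *)
Definition rhoG g : {mpoly C[k * m]} -> {mpoly C[k * m]} :=
  rho (ul g) (lr (invmx g)).

Lemma levi_unipotent_blocks u : levi_unipotent k u ->
  upper_uni (ul u) /\ lower_uni (lr (invmx u)).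
Proof.
move=> [lu u1 u0]; split.
  by split=> [a b ba|a]; rewrite mxE ?u1 // u0.
apply: lower_uni_inv (lr_inv (levi_parabolic lu)).
by split=> [a b ab|a]; rewrite mxE ?u1 // u0 // bot_idx_lt.
Qed.

Lemma levi_unipotent_lift A B : upper_uni A -> lower_uni B ->
  exists u, [/\ levi_unipotent k u, ul u = A & lr (invmx u) = B].
Proof.
move=> uA lB; have AB : sl_pair A B.
  by rewrite /sl_pair det_upper_uni // det_lower_uni // oner_eq0.
have Bu : B \in unitmx by rewrite unitmxE det_lower_uni // unitr1.
have [lD D1] := lower_uni_inv lB (mulmxV Bu).
have [u [lu ulu lru Bu']] := levi_lift (mulVmx Bu) AB; exists u; split=> //.
have [u1 ur0 ll0] := (levi_ll u).1 lu.
have eA a a' : u (top_idx a) (top_idx a') = A a a' by rewrite -ulu mxE.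
have eD b b' : u (bot_idx b) (bot_idx b') = invmx B b b' by rewrite -lru mxE.
split=> // [i|i j]; have [[a|b] ->] := block_idxP i => /=.
- by rewrite eA uA.2.
- by rewrite eD D1.
- have [[a'|b'] ->] := block_idxP j => /= ji; first by rewrite eA uA.1.
  by have /matrixP/(_ a b') := ur0; rewrite !mxE.
have [[a'|b'] ->] := block_idxP j => ji.
  by have /matrixP/(_ b a') := ll0; rewrite !mxE.
by rewrite /= eD lD // -bot_idx_lt.
Qed.

Lemma torus_levi t : torus t -> levi k t.
Proof.
move=> [t1 t0]; split=> // i j; have [->|/t0 //] := eqVneq i j.
by rewrite eqxx.
Qed.

Lemma torus_neq0 t i : torus t -> t i i != 0.
Proof.
move=> [t1 t0]; move: t1; rewrite det_lower; last first.
  by move=> a b ab; rewrite t0 // -val_eqE ltn_eqF.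
move=> t1; have : \prod_i t i i != 0 by rewrite t1 oner_eq0.
by move/prodf_neq0; apply.
Qed.

Lemma torus_blocks t : torus t ->
  ul t = diag_mx (\row_a t (top_idx a) (top_idx a)) /\
  lr (invmx t) = diag_mx (\row_b (t (bot_idx b) (bot_idx b))^-1).
Proof.
move=> tt; have [t1 t0] := tt; split.
  apply/matrixP => a a'; rewrite !mxE; case: eqP => [->|/eqP ne];
    first by rewrite mulr1n.
  by rewrite t0 ?mulr0n // (inj_eq top_idx_inj).
have Du : lr t \in unitmx by case/mulmx1_unit: (lr_inv (levi_parabolic
  (torus_levi tt))).
apply: (can_inj (mulKmx Du)); rewrite (lr_inv (levi_parabolic (torus_levi tt))).
apply/matrixP => b b'; rewrite mul_mx_diag !mxE.
case: eqP => [->|/eqP ne]; first by rewrite divff // torus_neq0.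
by rewrite t0 ?mul0r // (inj_eq bot_idx_inj).
Qed.

Lemma torus_lift (x : 'rV[C]_k) (y : 'rV[C]_m) :
  sl_pair (diag_mx x) (diag_mx y) ->
  exists t, [/\ torus t, ul t = diag_mx x & lr (invmx t) = diag_mx y].
Proof.
move=> xy; have [exy x0] := xy.
have y0 b : y 0 b != 0.
  have : \prod_b y 0 b != 0 by rewrite -det_diag -exy.
  by move/prodf_neq0; apply.
have DB : diag_mx (\row_b (y 0 b)^-1) *m diag_mx y = 1%:M.
  rewrite mulmx_diag; apply/matrixP => b b'; rewrite !mxE.
  by case: eqP => // ->; rewrite mulVf.
have [t [lt ult lrt Bt]] := levi_lift DB xy; exists t; split=> //.
have [t1 ur0 ll0] := (levi_ll t).1 lt; split=> // i j.
have [[a|b] ->] := block_idxP i; have [[a'|b'] ->] := block_idxP j => /= ne.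
- have := congr1 (fun M : 'M_k => M a a') ult; rewrite !mxE => ->.
  by rewrite -(inj_eq top_idx_inj) (negPf ne).
- by have /matrixP/(_ a b') := ur0; rewrite !mxE.
- by have /matrixP/(_ b a') := ll0; rewrite !mxE.
- have := congr1 (fun M : 'M_m => M b b') lrt; rewrite !mxE => ->.
  by rewrite -(inj_eq bot_idx_inj) (negPf ne).
Qed.

End Blocks.

(** * Weights *)

Section Weights.

Variables (C : numClosedFieldType) (n : nat).
Implicit Types (t : 'M[C]_n.+1) (l : weight n).

Lemma weight_charD l l' t : torus t ->
  weight_char (l + l') t = weight_char l t * weight_char l' t.
Proof.
move=> tt; rewrite /weight_char -big_split; apply: eq_bigr => j _ /=.
rewrite mxE expfzDr //; apply/prodf_neq0 => a _; exact: torus_neq0.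
Qed.

Lemma weight_char0 t : weight_char (0 : weight n) t = 1.
Proof. by rewrite /weight_char big1 // => j _; rewrite mxE expr0z. Qed.

Lemma weight_charMn l e t : torus t ->
  weight_char (l *+ e) t = weight_char l t ^+ e.
Proof.
move=> tt; elim: e => [|e IHe]; first by rewrite mulr0n weight_char0.
by rewrite mulrS weight_charD // IHe exprS.
Qed.

Lemma weight_char_fweight j t : (0 < j <= n)%N ->
  weight_char (fweight n j) t = \prod_(a < n.+1 | (a < j)%N) t a a.
Proof.
case: j => // j lt_jn; rewrite /weight_char (bigD1 (Ordinal lt_jn)) //=.
rewrite mxE eqxx expr1z [X in _ * X]big1 ?mulr1 // => i.
by rewrite -val_eqE /= mxE eqSS => /negPf ->; rewrite expr0z.
Qed.

(** The coroot of [alpha_j] reads off the coordinate on [lambda_j]. *)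
Lemma weight_char_inj l l' :
  (forall t, torus t -> weight_char l t = weight_char l' t) -> l = l'.
Proof.
move=> ll'; apply/rowP => j.
pose t : 'M[C]_n.+1 := diag_mx (\row_i
  (if i == j :> nat then 2 else if i == j.+1 :> nat then 2^-1 else 1)).
have two0 : (2 : C) != 0 by rewrite pnatr_eq0.
pose j0 : 'I_n.+1 := widen_ord (leqnSn n) j.
have tE (a : 'I_n.+1) : t a a = if a == j :> nat then 2 else
    if a == j.+1 :> nat then 2^-1 else 1 by rewrite !mxE eqxx mulr1n.
have partial (i : 'I_n) : \prod_(a < n.+1 | (a <= i)%N) t a a =
    if i == j then 2 else 1.
  have [lt_ij|lt_ji|eq_ij] := ltngtP i j.
  - rewrite -val_eqE /= (ltn_eqF lt_ij) big1 // => a le_ai.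
    rewrite tE (ltn_eqF (leq_ltn_trans le_ai lt_ij)).
    by rewrite (ltn_eqF (leq_ltn_trans le_ai (leqW lt_ij))).
  - rewrite -val_eqE /= (gtn_eqF lt_ji) (bigD1 j0) /=; last exact: ltnW.
    have lt_j1 : (j.+1 < n.+1)%N by rewrite ltnS; apply: ltn_ord.
    rewrite (bigD1 (Ordinal lt_j1)) /=; last first.
      by rewrite lt_ji -val_eqE /= gtn_eqF.
    rewrite !tE /= !eqxx (gtn_eqF (ltnSn j)) big1 ?mulr1 ?divff // => a.
    by rewrite -!val_eqE /= tE => /andP[/andP[_ /negPf ->] /negPf ->].
  - have -> : i = j by apply: val_inj.
    rewrite eqxx (bigD1 j0) //= tE eqxx big1 ?mulr1 // => a /andP[le_aj].
    by rewrite -val_eqE /= tE => /negPf ->; rewrite ltn_eqF // ltnS.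
have tt : torus t.
  split; last by move=> a b ab; rewrite mxE (negPf ab) mulr0n.
  have lt_j1 : (j.+1 < n.+1)%N by rewrite ltnS; apply: ltn_ord.
  rewrite det_diag (bigD1 j0) //= (bigD1 (Ordinal lt_j1)) /=; last first.
    by rewrite -val_eqE /= gtn_eqF.
  rewrite !mxE /= !eqxx (gtn_eqF (ltnSn j)) big1 ?mulr1 ?divff // => a.
  by rewrite -!val_eqE /= mxE => /andP[/negPf -> /negPf ->].
have wE (w : weight n) : weight_char w t = 2 ^ (w 0 j).
  rewrite /weight_char (bigD1 j) //= partial eqxx big1 ?mulr1 // => i /negPf ij.
  by rewrite partial ij exp1rz.
have ratE (z : int) : (2 : C) ^ z = ratr ((2 : rat) ^ z).
  by rewrite fmorphXz rmorph_nat.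
have := ll' t tt; rewrite !wE !ratE => /fmorph_inj.
by apply: ieexprIz; rewrite ?ltr0n // pnatr_eq1.
Qed.

Variable k : nat.
Hypotheses (k_gt0 : (0 < k)%N) (k_le : (k <= n.+1 - k)%N).

Local Notation m := (n.+1 - k)%N.
Local Notation ul := (ul k_le).
Local Notation lr := (@lr C n k).
Local Notation lmon := (@lmon C k m k_le).
Local Notation rhoG := (rhoG k_le).

Definition lmon_weight (e : 'I_k -> nat) : weight n :=
  \sum_(j < k) (fweight n j.+1 + fweight n (n.+1 - j.+1)) *+ e j.

(** As [\det t = 1], the product of all but the last [j.+1] diagonal entries of
    [t] is the inverse of the product of the last [j.+1]. *)
Lemma weight_char_lminor (j : 'I_k) t : torus t ->
  weight_char (fweight n j.+1 + fweight n (n.+1 - j.+1)) t =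
  lminor_char k_le j (ul t) (lr (invmx t)).
Proof.
move=> tt; have [-> ->] := torus_blocks k_le tt.
have le_jn : (j < n)%N.
  have := leq_trans (leq_trans (ltn_ord j) k_le) (leq_sub2l n.+1 k_gt0).
  by rewrite subn1.
rewrite weight_charD // !weight_char_fweight ?le_jn //; last first.
  by rewrite subSS subn_gt0 le_jn leq_subr.
rewrite /lminor_char; congr (_ * _).
  rewrite (big_ord_narrow (leqW le_jn)); apply: eq_bigr => a _.
  rewrite !mxE eqxx mulr1n; congr (t _ _); exact: val_inj.
have [t1 _] := tt; move: t1; rewrite det_lower; last first.
  by move=> a b ab; rewrite tt.2 // -val_eqE ltn_eqF.
rewrite (bigID (fun a : 'I_n.+1 => (a < n.+1 - j.+1)%N)) /= => t1.
set p := \prod_(a < n.+1 | _) _ in t1 *; set q := \prod_(a < n.+1 | _) _ in t1.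
have -> : p = q^-1.
  have q0 : q != 0 by apply: contra_eq_neq t1 => ->;
    rewrite mulr0 eq_sym oner_eq0.
  by apply: (mulIf q0); rewrite t1 mulVf.
rewrite /q (reindex_inj rev_ord_inj) /=.
rewrite (eq_bigl (fun a : 'I_n.+1 => (a < j.+1)%N)); last first.
  move=> a; rewrite -leqNgt !subSS leq_sub2lE // -ltnS; exact: ltn_ord.
rewrite (big_ord_narrow (leqW le_jn)) -prodfV; apply: eq_bigr => b _.
rewrite !mxE eqxx mulr1n; congr (t _ _)^-1; exact: val_inj.
Qed.

Lemma weight_char_lmon e t : torus t ->
  weight_char (lmon_weight e) t = lmon_char k_le e (ul t) (lr (invmx t)).
Proof.
move=> tt; rewrite /lmon_weight /lmon_char.
rewrite (big_morph (fun l => weight_char l t) (id1 := 1) (op1 := *%R));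
  last first.
- exact: weight_char0.
- by move=> l l'; apply: weight_charD.
by apply: eq_bigr => j _; rewrite weight_charMn // weight_char_lminor.
Qed.

Lemma lmon_highest_weight e :
  highest_weight_vector k rhoG (lmon_weight e) (lmon e).
Proof.
split=> [|u /(levi_unipotent_blocks k_le)[uA lB]|t tt].
- exact: lmon_neq0.
- exact: rho_lmon_uni.
rewrite weight_char_lmon //; have [ult lrt] := torus_blocks k_le tt.
apply: rho_lmon; rewrite ?ult ?lrt => i j ij; rewrite mxE -val_eqE /=.
  by rewrite (gtn_eqF ij).
by rewrite (ltn_eqF ij).
Qed.

Lemma highest_weight_model l q : highest_weight_vector k rhoG l q ->
  exists2 c, c != 0 & exists e, q = c *: lmon e.
Proof.
move=> [q0 qU qT]; apply: highest_weight_lmon => //.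
  move=> A B uA lB; have [u [uu <- <-]] := levi_unipotent_lift k_le uA lB.
  exact: qU.
move=> x y xy; have [t [tt <- <-]] := torus_lift k_le xy.
by exists (weight_char l t); apply: qT.
Qed.

End Weights.

Lemma highest_weight_uniq (C : numClosedFieldType) n k (W : lmodType C)
    (rho : 'M[C]_n.+1 -> W -> W) l l' v :
  highest_weight_vector k rho l v -> highest_weight_vector k rho l' v -> l = l'.
Proof.
move=> [v0 _ vl] [_ _ vl']; apply: (@weight_char_inj C) => t tt.
apply/eqP; rewrite -subr_eq0; have /eqP : (weight_char l t - weight_char l' t)
  *: v = 0.
  by rewrite scalerBl -vl // -vl' // subrr.
by rewrite scaler_eq0 (negPf v0) orbF.
Qed.

(** The weights of monomials in the minors are separated by the torus elements
    of [tau_row] and [tau_col], whose eigenvalues are powers of 4. *)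
Lemma lmon_weight_inj (C : numClosedFieldType) n k
    (k_gt0 : (0 < k)%N) (k_le : (k <= n.+1 - k)%N) e e' :
  lmon_weight n e = lmon_weight n (k := k) e' -> e =1 e'.
Proof.
move=> ee'; apply: tail_sum_inj => a.
have [t [tt ult lrt]] := torus_lift k_le (sl_pair_tau C k_le a).
have := rho_tau_lmon C k_le a e; rewrite -ult -lrt.
have [_ _ /(_ t tt)] := lmon_highest_weight C k_gt0 k_le e; rewrite /rhoG => ->.
have := rho_tau_lmon C k_le a e'; rewrite -ult -lrt.
have [_ _ /(_ t tt)] := lmon_highest_weight C k_gt0 k_le e';
  rewrite /rhoG => ->.
move=> /eqP; rewrite -subr_eq0 -scalerBl scaler_eq0 (negPf (lmon_neq0 _ _ _))
  orbF.
rewrite subr_eq0 => /eqP we' /eqP.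
rewrite -subr_eq0 -scalerBl scaler_eq0 (negPf (lmon_neq0 _ _ _)) orbF.
by rewrite subr_eq0 ee' we' => /eqP/four_inj.
Qed.

(** * Symmetric algebras of modules of matrices *)

Lemma comp_mpolyK (F : fieldType) D1 D2 (u : D1.-tuple {mpoly F[D2]})
    (v : D2.-tuple {mpoly F[D1]}) :
  (forall i, tnth u i \mPo v = 'X_i) ->
  cancel (fun f : {mpoly F[D1]} => f \mPo u) (fun f => f \mPo v).
Proof.
move=> uv f; rewrite comp_mpolyA -[RHS]comp_mpoly_id; congr (_ \mPo _).
by apply: eq_from_tnth => i; rewrite !tnth_mktuple.
Qed.

Lemma irreducible_elt_iso (A B : idomainType) (f : {rmorphism A -> B})
    (g : {rmorphism B -> A}) a :
  cancel f g -> cancel g f -> irreducible_elt a -> irreducible_elt (f a).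
Proof.
move=> fK gK [a0 aU aI]; split=> [||x y fxy].
- by apply: contraNneq a0 => fa0; rewrite -[a]fK fa0 rmorph0.
- by apply: contra aU => fU; rewrite -[a]fK rmorph_unit.
have [|gx|gy] := aI (g x) (g y); first by rewrite -rmorphM -fxy fK.
  by left; rewrite -[x]gK rmorph_unit.
by right; rewrite -[y]gK rmorph_unit.
Qed.

Lemma irreducible_eltZ (F : fieldType) D c (f : {mpoly F[D]}) :
  c != 0 -> irreducible_elt (c *: f) -> irreducible_elt f.
Proof.
move=> c0 [f0 fU fI].
have cU : c%:MP_[D] \is a GRing.unit by rewrite rmorph_unit ?unitfE.
have cfE : c *: f = c%:MP * f by rewrite mul_mpolyC.
split=> [||a b fab].
- by apply: contraNneq f0 => ->; rewrite scaler0.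
- by apply: contra fU => fu; rewrite cfE unitrM cU.
have [|ca|] := fI (c *: a) b; first by rewrite fab scalerAl.
  by left; move: ca; rewrite -mul_mpolyC unitrM cU.
by right.
Qed.

Lemma sym_inj_linear (F : fieldType) (V : vectType F) : linear (@sym_inj F V).
Proof.
move=> a u v; rewrite /sym_inj scaler_sumr -big_split; apply: eq_bigr => i _.
by rewrite linearP /= scalerDl scalerA.
Qed.

Section SymmetricAlgebraOfMatrices.

Variables (C : numClosedFieldType) (n k : nat).
Hypotheses (k_gt0 : (0 < k)%N) (k_le : (k <= n.+1 - k)%N).

Local Notation m := (n.+1 - k)%N.
Local Notation Q := {mpoly C[k * m]}.
Local Notation ul := (ul k_le).
Local Notation lr := (@lr C n k).
Local Notation lmon := (@lmon C k m k_le).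
Local Notation rhoG := (@rhoG C n k k_le).

Variables (V : vectType C) (rhoV : 'M[C]_n.+1 -> V -> V).
Variables (x : {linear V -> 'M[C]_(k, m)}) (y : {linear 'M[C]_(k, m) -> V}).
Hypotheses (xK : cancel x y) (yK : cancel y x).
Hypothesis x_equiv : forall g v, parabolic k g ->
  x (rhoV g v) = ul g *m x v *m lr (invmx g).

Local Notation W := (Sym C V).
Local Notation act := (sym_act rhoV).

Definition to_model (f : W) : Q :=
  f \mPo [tuple lform (mxvec (x (vbasis {:V})`_i)) | i < \dim {:V}].

Definition of_model (q : Q) : W :=
  q \mPo [tuple sym_inj (y (vec_mx (delta_mx 0 i))) | i < k * m].

HB.instance Definition _ := GRing.LRMorphism.copy to_model
  (comp_mpoly [tuple lform (mxvec (x (vbasis {:V})`_i)) | i < \dim {:V}]).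
HB.instance Definition _ := GRing.LRMorphism.copy of_model
  (comp_mpoly [tuple sym_inj (y (vec_mx (delta_mx 0 i))) | i < k * m]).

Lemma to_model_inj v : to_model (sym_inj v) = lform (mxvec (x v)).
Proof.
rewrite /sym_inj (linear_sum to_model) [in RHS](coord_vbasis (memvf v)).
rewrite !linear_sum; apply: eq_bigr => i _.
rewrite (linearZ_LR to_model) !linearZ; congr (_ *: _).
by rewrite [LHS]comp_mpolyXU -tnth_nth tnth_mktuple.
Qed.

Lemma of_model_lform M : of_model (lform (mxvec M)) = sym_inj (y M).
Proof.
pose s : {linear V -> W} := HB.pack (@sym_inj C V)
  (GRing.isLinear.Build _ _ _ _ (@sym_inj C V) (@sym_inj_linear C V)).
rewrite /lform (linear_sum of_model) -[in RHS](mxvecK M).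
rewrite [in RHS](row_sum_delta (mxvec M)) -[RHS]/(s _) !linear_sum.
apply: eq_bigr => i _; rewrite (linearZ_LR of_model) !linearZ; congr (_ *: _).
by rewrite [LHS]comp_mpolyXU -tnth_nth tnth_mktuple.
Qed.

Lemma to_modelK : cancel to_model of_model.
Proof.
apply: comp_mpolyK => i; rewrite tnth_mktuple -/(of_model _) of_model_lform xK.
have fr := basis_free (vbasisP {:V}).
rewrite /sym_inj (bigD1 i) //= (coord_free _ _ fr) eqxx scale1r big1 ?addr0 //.
by move=> j /negPf ji; rewrite (coord_free _ _ fr) eq_sym ji scale0r.
Qed.

Lemma of_modelK : cancel of_model to_model.
Proof.
apply: comp_mpolyK => i; rewrite tnth_mktuple -/(to_model _) to_model_inj yK.
by rewrite vec_mxK lform_delta.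
Qed.

Lemma to_model_act g f : parabolic k g ->
  to_model (act g f) = rhoG g (to_model f).
Proof.
move=> pg; rewrite /to_model /sym_act /rhoG /rho /msubst !comp_mpolyA.
congr (_ \mPo _); apply: eq_from_tnth => i; rewrite !tnth_mktuple.
rewrite -/(to_model _) -/(msubst _ _) -/(rho _ _ _) to_model_inj x_equiv //.
by rewrite rho_lform.
Qed.

Lemma of_model_act g q : parabolic k g ->
  of_model (rhoG g q) = act g (of_model q).
Proof. by move=> pg; rewrite -{1}[q]of_modelK -to_model_act // to_modelK. Qed.

Lemma to_model_homog r f : f \is r.-homog -> to_model f \is r.-homog.
Proof. by apply: comp_mpoly_homog => i; rewrite tnth_mktuple lform_homog. Qed.

Lemma of_model_homog r q : q \is r.-homog -> of_model q \is r.-homog.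
Proof.
apply: comp_mpoly_homog => i; rewrite tnth_mktuple.
by apply: rpred_sum => j _; rewrite rpredZ // dhomogX /= mdeg1.
Qed.

Lemma highest_weight_to_model l f :
  highest_weight_vector k act l f <->
  highest_weight_vector k rhoG l (to_model f).
Proof.
have inj := can_inj to_modelK.
split=> [[f0 fU fT]|[f0 fU fT]]; split=> [|u uu|t tt].
- by rewrite -(rmorph0 to_model) (inj_eq inj).
- by rewrite -to_model_act ?fU //; case: uu => lu _ _; apply: levi_parabolic lu.
- rewrite -to_model_act ?fT // ?(linearZ_LR to_model) //.
  exact: levi_parabolic (torus_levi k tt).
- by move: f0; rewrite -(rmorph0 to_model) (inj_eq inj).
- apply: inj; rewrite to_model_act ?fU //; case: uu => lu _ _.
  exact: levi_parabolic lu.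
- apply: inj; rewrite to_model_act ?fT // ?(linearZ_LR to_model) //.
  exact: levi_parabolic (torus_levi k tt).
Qed.

Definition E_sub (e : 'I_k -> nat) (f : W) : Prop :=
  orbit_span k_le e (to_model f).

Lemma E_sub_highest_weight e : exists2 f, E_sub e f &
  highest_weight_vector k act (lmon_weight n e) f.
Proof.
exists (of_model (lmon e)); first by rewrite /E_sub of_modelK;
  apply: orbit_span_lmon.
by apply/highest_weight_to_model; rewrite of_modelK; apply: lmon_highest_weight.
Qed.

Section Subgroup.

(** The unipotent radical of the parabolic group acts trivially, so that the
    parabolic group and its Levi part have the same submodules. *)
Variable H : 'M[C]_n.+1 -> Prop.
Hypothesis leviH : forall g, levi k g -> H g.
Hypothesis Hpar : forall g, H g -> parabolic k g.

Lemma submodule_stable (S : W -> Prop) :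
  submodule H act S -> stable (fun q => S (of_model q)).
Proof.
move=> [subS stS]; split=> [|A B q AB Sq].
  split=> [|a u v Su Sv]; first by rewrite (rmorph0 of_model); apply: subS.1.
  by rewrite (linearP of_model); apply: subS.2.
have [g [lg <- <-]] := levi_lift_pair k_le AB.
by rewrite -/(rhoG g q) of_model_act; [apply: stS => //;
  apply: leviH | apply/Hpar/leviH].
Qed.

Lemma stable_submodule (S : Q -> Prop) :
  stable S -> submodule H act (fun f => S (to_model f)).
Proof.
move=> [subS stS]; split=> [|g f Hg Sf].
  split=> [|a u v Su Sv]; first by rewrite (rmorph0 to_model); apply: subS.1.
  by rewrite (linearP to_model); apply: subS.2.
rewrite to_model_act; last exact: Hpar.
by apply: stS => //; apply/parabolic_sl_pair/Hpar.
Qed.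

Lemma nonzero_of_model (S : W -> Prop) :
  nonzero S -> nonzero (fun q => S (of_model q)).
Proof.
move=> [f Sf f0]; exists (to_model f); first by rewrite to_modelK.
by rewrite -(rmorph0 to_model) (inj_eq (can_inj to_modelK)).
Qed.

Lemma E_sub_irreducible e : irreducible_module H act (E_sub e).
Proof.
split=> [||S stS SE nzS f fE].
- exact: stable_submodule (orbit_span_stable C k_le e).
- by have [f fE [f0 _ _]] := E_sub_highest_weight e; exists f.
rewrite -[f]to_modelK; apply: (@orbit_span_irreducible _ _ _ k_le k_gt0 e
  (fun q => S (of_model q))) => //.
- exact: submodule_stable.
- by move=> q /SE; rewrite /E_sub of_modelK.
- exact: nonzero_of_model.
Qed.

Lemma submodule_lmon (S : W -> Prop) : submodule H act S -> nonzero S ->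
  exists e, S (of_model (lmon e)).
Proof.
move=> /submodule_stable stS /nonzero_of_model.
exact: (exists_lmon k_le k_gt0 stS).
Qed.

End Subgroup.

Lemma highest_weight_of_model l f : highest_weight_vector k act l f ->
  exists2 c, c != 0 &
    exists2 e, l = lmon_weight n e & f = c *: of_model (lmon e).
Proof.
move=> hw; have /highest_weight_model[c c0 [e fE]] := (highest_weight_to_model
  l f).1 hw.
have fE' : f = c *: of_model (lmon e).
  by rewrite -(linearZ_LR of_model) /= -fE to_modelK.
exists c => //; exists e => //.
have hwe : highest_weight_vector k rhoG (lmon_weight n e) (c *: lmon e).
  have [_ eU eT] := lmon_highest_weight C k_gt0 k_le e.
  split=> [|u uu|t tt]; first by rewrite scaler_eq0 negb_or c0 lmon_neq0.
    by rewrite /rhoG linearZ /= -/(rhoG _ _) eU.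
  by rewrite /rhoG linearZ /= -/(rhoG _ _) eT // !scalerA mulrC.
apply: highest_weight_uniq hwe; rewrite -fE.
exact/highest_weight_to_model.
Qed.

Lemma sym_decomposition r :
  direct_sum
    (fun i : {ffun 'I_k -> 'I_r.+1} => (\sum_(j < k) j.+1 * i j)%N == r)
    (fun i => E_sub (fun j => i j)) (@Sym_deg C V r).
Proof.
split=> [i f ir fE|f fr|w wE w0 i ir].
- rewrite /Sym_deg -[f]to_modelK; apply: of_model_homog.
  by have := orbit_span_homog fE; rewrite (eqP ir).
- have [w wE fE] := homog_decomposition k_le k_gt0 (to_model_homog fr).
  exists (fun i => of_model (w i)) => [i ir|];
    first by rewrite /E_sub of_modelK; apply: wE.
  by rewrite -[LHS]to_modelK fE (linear_sum of_model).
apply: (can_inj to_modelK); rewrite (rmorph0 to_model).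
apply: (homog_decomposition_uniq (w := fun i => to_model (w i))) ir => //.
by rewrite -(linear_sum to_model) w0 (rmorph0 to_model).
Qed.

(** Isomorphic irreducible submodules contain the same monomial in the minors,
    so that their intersection is a nonzero submodule of both. *)
Lemma sym_multiplicity_free : multiplicity_free (@levi C n k) act.
Proof.
move=> S1 S2 [sm1 nz1 irr1] [sm2 nz2 irr2] [phi [phi12 phiL phiH phi_inj _]].
have [e1 S1e] := submodule_lmon (fun _ => id) (@levi_parabolic C n k k_le) sm1
  nz1.
set v := of_model (lmon e1) in S1e.
have hwv : highest_weight_vector k act (lmon_weight n e1) v.
  by apply/highest_weight_to_model; rewrite of_modelK;
    apply: lmon_highest_weight.
have S10 : S1 0 := sm1.1.1.
have phi0 : phi 0 = 0.
  have := phiL 1 0 0 S10 S10; rewrite scaler0 addr0 scale1r => /esym/eqP.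
  by rewrite -subr_eq0 addrK => /eqP.
have phiZ a u : S1 u -> phi (a *: u) = a *: phi u.
  by move=> S1u; have := phiL a u 0 S1u S10; rewrite !addr0 phi0 addr0.
have hwphi : highest_weight_vector k act (lmon_weight n e1) (phi v).
  have [v0 vU vT] := hwv; split=> [|u uu|t tt].
  - by apply: contra_neq v0 => pv0; apply: phi_inj => //; rewrite phi0.
  - by rewrite -phiH ?vU //; case: uu.
  - by rewrite -phiH ?vT // ?phiZ //; apply: torus_levi.
have [c c0 [e /(lmon_weight_inj C k_gt0 k_le) ee phivE]] :=
  highest_weight_of_model hwphi.
have S2v : S2 v.
  have -> : v = c^-1 *: phi v.
    rewrite phivE scalerA mulVf // scale1r; congr of_model.
    by apply: eq_bigr => j _; rewrite ee.
  by apply: (subspaceZ sm2.1); apply: phi12.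
pose S f := S1 f /\ S2 f.
have smS : submodule (@levi C n k) act S.
  split=> [|g f lg [f1 f2]]; last by split; [apply: sm1.2 | apply: sm2.2].
  split=> [|a f f' [f1 f2] [f1' f2']]; first by split;
    [apply: sm1.1.1 | apply: sm2.1.1].
  by split; [apply: sm1.1.2 | apply: sm2.1.2].
have nzS : nonzero S by exists v => //; case: hwv.
move=> f; split=> [/(irr1 S smS (fun _ => @proj1 _ _) nzS)[]|] //.
by move/(irr2 S smS (fun _ => @proj2 _ _) nzS) => [].
Qed.

Lemma to_model_irreducible f :
  irreducible_elt (to_model f) -> irreducible_elt f.
Proof.
rewrite -{2}[f]to_modelK; apply: (@irreducible_elt_iso _ _ of_model to_model).
  exact: of_modelK.
exact: to_modelK.
Qed.

Lemma of_model_irreducible q :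
  irreducible_elt (of_model q) -> irreducible_elt q.
Proof.
rewrite -{2}[q]of_modelK; apply: (@irreducible_elt_iso _ _ to_model of_model).
  exact: to_modelK.
exact: of_modelK.
Qed.

End SymmetricAlgebraOfMatrices.

(** * Fundamental highest weights *)

Lemma msize_homog (F : fieldType) D r (f : {mpoly F[D]}) :
  f != 0 -> f \is r.-homog -> msize f = r.+1.
Proof.
move=> f0 fr; rewrite (mpolySpred _ f0); congr _.+1.
exact: dhomog_uniq f0 (dhomog_msize fr) fr.
Qed.

Section FundamentalWeights.

Variables (C : numClosedFieldType) (n k : nat).
Hypotheses (k_gt0 : (0 < k)%N) (k_le : (k <= n.+1 - k)%N).

Local Notation m := (n.+1 - k)%N.
Local Notation lmon := (@lmon C k m k_le).
Local Notation lminor := (@lminor C k m k_le).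

Lemma lmon_single (j : 'I_k) : lmon (fun i => i == j) = lminor j.
Proof.
rewrite /lmon (bigD1 j) //= eqxx expr1 big1 ?mulr1 // => i /negPf ->.
by rewrite expr0.
Qed.

Lemma lmon_weight_single (j : 'I_k) : lmon_weight n (fun i : 'I_k => i == j) =
  fweight n j.+1 + fweight n (n.+1 - j.+1).
Proof.
rewrite /lmon_weight (bigD1 j) //= eqxx mulr1n big1 ?addr0 // => i /negPf ->.
by rewrite mulr0n.
Qed.

(** Splitting off one minor leaves a monomial which must be a unit, so that all
    its exponents vanish by degree. *)
Lemma lmon_irreducible (e : 'I_k -> nat) :
  irreducible_elt (lmon e) -> exists j : 'I_k, e =1 (fun i => i == j : nat).
Proof.
move=> [_ eU eI].
have [j ej] : exists j : 'I_k, (0 < e j)%N.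
  apply/existsP; apply: contraR eU; rewrite negb_exists => /forallP e0.
  rewrite (_ : lmon e = 1) ?unitr1 // /lmon big1 // => j _.
  by move: (e0 j); rewrite -eqn0Ngt => /eqP ->; rewrite expr0.
pose e' i := (e i - (i == j))%N.
have eE : lmon e = lminor j * lmon e'.
  rewrite -lmon_single /lmon -big_split; apply: eq_bigr => i _ /=.
  rewrite -exprD /e' subnKC //; case: eqP => // ->; exact: ej.
have [_ jU _] := lminor_irreducible C k_le j.
have [jU'|e'U] := eI _ _ eE; first by rewrite jU' in jU.
exists j => i.
have nz := lmon_neq0 C k_le e'.
have deg0 : mdeg (mlead (lmon e')) = 0%N.
  have := wdeg_eq0 (wdeg_unit (fun=> 1%N) e'U) (mlead_supp nz).
  by rewrite /wtdeg -big_distrr /= mul1n -mdegE.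
have /dhomogP/(_ _ (mlead_supp nz)) /= := lmon_homog C k_le e'.
rewrite deg0 => /esym/eqP; rewrite sum_nat_eq0 => /forallP/(_ i) /=.
rewrite muln_eq0 /= /e' subn_eq0; case: eqP => [-> |_];
  last by rewrite leqn0 => /eqP.
by move=> le_ej; apply/eqP; rewrite eqn_leq le_ej ej.
Qed.

Variables (V : vectType C) (rhoV : 'M[C]_n.+1 -> V -> V).
Variables (x : {linear V -> 'M[C]_(k, m)}) (y : {linear 'M[C]_(k, m) -> V}).
Hypotheses (xK : cancel x y) (yK : cancel y x).
Hypothesis x_equiv : forall g v, parabolic k g ->
  x (rhoV g v) = ul k_le g *m x v *m @lr C n k (invmx g).

Lemma sym_fundamental (l : weight n) d :
  (exists S, irreducible_module (@levi C n k) (sym_act rhoV) S /\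
   exists h : Sym C V, [/\ S h, highest_weight_vector k (sym_act rhoV) l h,
     irreducible_elt h & msize h = d.+1]) <->
  exists j : nat,
    [/\ (1 <= j <= k)%N, l = fweight n j + fweight n (n.+1 - j) & d = j].
Proof.
split=> [[S [_ [h [_ hw hI hd]]]]|[j [/andP[j_gt0 lt_jk] -> ->]]].
  have [c c0 [e lE hE]] := highest_weight_of_model k_gt0 xK x_equiv hw.
  move: hI; rewrite hE => /(irreducible_eltZ c0)/(of_model_irreducible xK yK).
  case/lmon_irreducible => j ej; exists j.+1.
  have lmonE : lmon e = lminor j.
    by rewrite -lmon_single; apply: eq_bigr => i _; rewrite ej.
  split; first exact: ltn_ord.
    rewrite lE -lmon_weight_single; apply: eq_bigr => i _; by rewrite ej.
  have [h0 _ _] := hw; apply/eqP; rewrite -eqSS -hd; apply/eqP.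
  apply: msize_homog h0 _; rewrite hE lmonE; apply: rpredZ.
  exact/of_model_homog/lminor_homog.
case: j j_gt0 lt_jk => // j _ lt_jk.
pose j0 := Ordinal lt_jk; pose e (i : 'I_k) : nat := i == j0.
exists (E_sub k_le x e); split.
  exact: (E_sub_irreducible k_gt0 xK yK x_equiv (fun _ =>
    id) (@levi_parabolic C n k k_le)).
have hw : highest_weight_vector k (sym_act rhoV)
    (fweight n j.+1 + fweight n (n.+1 - j.+1)) (of_model y (lmon e)).
  rewrite -(lmon_weight_single j0); apply/(highest_weight_to_model xK x_equiv).
  by rewrite of_modelK //; apply: lmon_highest_weight.
exists (of_model y (lmon e)); split=> //.
- by rewrite /E_sub of_modelK //; apply: orbit_span_lmon.
- apply: (to_model_irreducible xK yK); rewrite of_modelK // lmon_single.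
  exact: lminor_irreducible.
have [h0 _ _] := hw; apply: msize_homog h0 _.
by rewrite lmon_single; apply/of_model_homog/(lminor_homog C k_le j0).
Qed.

End FundamentalWeights.

(** * The tangent module and its double dual *)

Lemma linfunE (F : fieldType) (U V : vectType F) (f : U -> V) :
  linear f -> linfun f =1 f.
Proof.
move=> fL u; pose h : {linear U -> V} := HB.pack f (GRing.isLinear.Build _ _ _
  _ f fL).
by rewrite -[linfun f]/(linfun h) lfunE.
Qed.

Section DoubleDual.

Variables (F : fieldType) (N : nat).

Lemma dual_actE (V : vectType F) (rho : 'M[F]_N -> V -> V) g phi v :
  linear (rho (invmx g)) -> dual_act rho g phi v = phi (rho (invmx g) v).
Proof.
by move=> rL; rewrite /dual_act linfunE // => a u w; rewrite rL linearP.
Qed.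

Lemma dual_act_linear (V : vectType F) (rho : 'M[F]_N -> V -> V) g :
  (forall h, linear (rho h)) -> linear (dual_act rho g).
Proof.
move=> rL a phi psi; apply/lfunP => v.
by rewrite !lfunE /= !lfunE /= !dual_actE // !lfunE /= !lfunE.
Qed.

Variables (V : vectType F) (rho : 'M[F]_N -> V -> V).
Hypothesis rho_linear : forall g, linear (rho g).

Definition bidual (v : V) : dual (dual V) :=
  linfun (fun phi : dual V => phi v : F^o).

Lemma bidualE v phi : bidual v phi = phi v.
Proof.
by rewrite /bidual linfunE // => a f g; rewrite !lfunE /= !lfunE.
Qed.

Lemma bidual_linear : linear bidual.
Proof.
by move=> a u v; apply/lfunP => phi; rewrite !lfunE /= !lfunE /= !bidualE
  linearP.
Qed.

HB.instance Definition _ :=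
  GRing.isLinear.Build F V (dual (dual V)) _ bidual bidual_linear.

Lemma bidual_act g v : dual_act (dual_act rho) g (bidual v) = bidual (rho g v).
Proof.
apply/lfunP => phi; rewrite dual_actE; last exact: dual_act_linear.
by rewrite !bidualE dual_actE // invmxK.
Qed.

Lemma dim_dual (U : vectType F) : dim (dual U) = dim U.
Proof. exact: muln1. Qed.

(** Evaluation is injective as the coordinate forms separate vectors, and hence
    bijective by dimension. *)
Lemma bidual_bij : exists2 f : {linear dual (dual V) -> V},
  cancel bidual f & cancel f bidual.
Proof.
have ker0 : lker (linfun bidual) == 0%VS.
  apply/lker0P => u v; rewrite !lfunE /= => /lfunP uv.
  rewrite (coord_vbasis (memvf u)) (coord_vbasis (memvf v)).
  apply: eq_bigr => i _; congr (_ *: _).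
  have := uv (linfun (coord (vbasis {:V}) i : V -> F^o)).
  by rewrite !bidualE !lfunE.
have lim : limg (linfun bidual) = fullv.
  apply/eqP; rewrite -(dimv_leqif_eq (subvf _)) limg_dim_eq; last first.
    by rewrite (eqP ker0) capv0.
  by rewrite !dimvf !dim_dual.
exists ((linfun bidual)^-1)%VF => u.
  by have := lker0_lfunK ker0 u; rewrite lfunE.
have := limg_lfunVK (f := linfun bidual) (x := u);
  rewrite lim memvf => /(_ isT).
by rewrite [linfun _ _]lfunE.
Qed.

End DoubleDual.

Section Tangent.

Variables (C : numClosedFieldType) (n k : nat).
Hypotheses (k_gt0 : (0 < k)%N) (k_le : (k <= n.+1 - k)%N).

Local Notation m := (n.+1 - k)%N.
Local Notation ul := (@ul C n k k_le).
Local Notation ur := (@ur C n k k_le).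
Local Notation lr := (@lr C n k).
Local Notation T := (tangent C n k).
Local Notation p := (parabolic_lie C n k).

Lemma parabolic_lie_sub : (p <= sl_space C n)%VS.
Proof. exact: capvSl. Qed.

Lemma mem_parabolic_lie_ur A : A \in sl_space C n -> (A \in p) = (ur A == 0).
Proof.
rewrite mem_sl => /eqP trA; apply/mem_parabolic_lie/eqP => [[_ /ur_eq0] //|A0].
by split=> //; apply/ur_eq0.
Qed.

Lemma mem_tangent (v : T) : vsval v \in sl_space C n.
Proof. exact: (subvP (diffvSl _ _) _ (subvsP v)). Qed.

Definition tangent_ur (v : T) : 'M[C]_(k, m) := ur (vsval v).

Lemma tangent_ur_linear : linear tangent_ur.
Proof. by move=> a u v; apply/matrixP => i j; rewrite !mxE. Qed.

HB.instance Definition _ := GRing.isLinear.Build C T 'M[C]_(k, m) _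
  tangent_ur tangent_ur_linear.

Lemma tangent_ur_pi A : A \in sl_space C n -> tangent_ur (quot_pi _ p A) = ur A.
Proof.
move=> slA; have Ap := quot_pi_sub slA parabolic_lie_sub.
have := subvP parabolic_lie_sub _ Ap; move/mem_parabolic_lie_ur; rewrite Ap.
move=> /esym/eqP/matrixP urA; apply/matrixP => i j; apply/esym/eqP.
by have := urA i j; rewrite !mxE => /eqP; rewrite subr_eq0.
Qed.

Lemma tangent_ur_inj : injective tangent_ur.
Proof.
move=> u v uv; apply/eqP; rewrite -subr_eq0 -[u - v]quot_piK.
rewrite quot_pi_eq0 ?parabolic_lie_sub ?mem_tangent //.
by rewrite mem_parabolic_lie_ur ?mem_tangent // -/(tangent_ur _) linearB /= uv
  subrr.
Qed.

(** The traceless matrix with upper right block [M] and no other block. *)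
Definition corner (M : 'M[C]_(k, m)) : 'M[C]_n.+1 :=
  (rowsub (top_idx k_le) 1%:M)^T *m M *m rowsub (@bot_idx n k) 1%:M.

Lemma ur_corner M : ur (corner M) = M.
Proof.
have -> : ur (corner M) = ul 1%:M *m M *m lr 1%:M.
  apply/matrixP => i j; rewrite /corner !mxE; apply: eq_bigr => b _;
    rewrite !mxE.
  by congr (_ * _); apply: eq_bigr => a _; rewrite !mxE eq_sym.
by rewrite ul1 lr1 mul1mx mulmx1.
Qed.

Lemma corner_sl M : corner M \in sl_space C n.
Proof.
rewrite mem_sl /corner mxtrace_mulC mulmxA.
have -> : rowsub (@bot_idx n k) 1%:M *m (rowsub (top_idx k_le) 1%:M)^T = ll
  k_le 1%:M :> 'M[C]__.
  by rewrite mul_rowsub_mx mul1mx; apply/matrixP => i j; rewrite !mxE eq_sym.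
by rewrite ll1 mul0mx mxtrace0.
Qed.

Lemma tangent_ur_bij : exists2 y : {linear 'M[C]_(k, m) -> T},
  cancel tangent_ur y & cancel y tangent_ur.
Proof.
pose y M : T := quot_pi _ p (corner M).
have yK : cancel y tangent_ur by move=> M; rewrite tangent_ur_pi ?ur_corner
  ?corner_sl.
have xK : cancel tangent_ur y by move=> v; apply: tangent_ur_inj; rewrite yK.
pose yL : {linear 'M[C]_(k, m) -> T} :=
  HB.pack y (GRing.isLinear.Build _ _ _ _ y (can2_linear xK yK)).
by exists yL.
Qed.

Lemma adjoint_linear (g : 'M[C]_n.+1) : linear (adjoint g).
Proof. by move=> a u v; rewrite /adjoint mulmxDr mulmxDl -scalemxAr
  -scalemxAl. Qed.

Lemma tangent_act_linear (g : 'M[C]_n.+1) : linear (@tangent_act C n k g).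
Proof.
move=> a u v; rewrite /tangent_act /quot_act -quot_pi_linear -adjoint_linear.
by rewrite linearP.
Qed.

Lemma tangent_ur_act (g : 'M[C]_n.+1) (v : T) : parabolic k g ->
  tangent_ur (tangent_act g v) = ul g *m tangent_ur v *m lr (invmx g).
Proof.
move=> pg; rewrite tangent_ur_pi ?ur_adjoint // mem_sl /adjoint.
have gu : g \in unitmx by case: pg => g1 _; rewrite unitmxE g1 unitr1.
by rewrite mxtrace_mulC mulmxA mulVmx // mul1mx -mem_sl mem_tangent.
Qed.

End Tangent.

(* As i_1 + 2 i_2 + ... + k i_k = r forces every i_j to be at most r, the index
   set of the decomposition is a subset of {ffun 'I_k -> 'I_r.+1}. *)
Theorem mainTheorem8 (R : realType) (n k : nat)
    (k_gt0 : (0 < k)%N) (k_le : (k <= n.+1 - k)%N) :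
  (forall r : nat,
     exists E : {ffun 'I_k -> 'I_r.+1} ->
                Sym R[i] (tangent R[i] n k) -> Prop,
       (forall i : {ffun 'I_k -> 'I_r.+1}, (\sum_(j < k) j.+1 * i j)%N = r ->
          is_E k (sym_act (@tangent_act R[i] n k))
            (\sum_(j < k) (fweight n j.+1 + fweight n (n.+1 - j.+1)) *+ i j)
            (E i)) /\
       direct_sum (fun i : {ffun 'I_k -> 'I_r.+1} =>
                     (\sum_(j < k) j.+1 * i j)%N == r)
         E (@Sym_deg R[i] (tangent R[i] n k) r)) /\
  poly_multiplicity_free k (dual_act (@tangent_act R[i] n k)) /\
  (forall (l : weight n) (d : nat),
     fundamental_highest_weight k (dual_act (@tangent_act R[i] n k)) l d <->
     exists j : nat,
       [/\ (1 <= j <= k)%N, l = fweight n j + fweight n (n.+1 - j) & d = j]).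
Proof.
pose C : numClosedFieldType := R[i].
have [y xK yK] := tangent_ur_bij C k_le.
have act := @tangent_ur_act C n k k_le.
have [z evK zK] := bidual_bij (tangent C n k).
pose x' : {linear dual (dual (tangent C n k)) -> 'M[C]_(k, n.+1 - k)} :=
  @tangent_ur C n k k_le \o z.
pose y' : {linear 'M[C]_(k, n.+1 - k) -> dual (dual (tangent C n k))} :=
  @bidual C (tangent C n k) \o y.
have x'K : cancel x' y' by move=> v; rewrite /= xK zK.
have y'K : cancel y' x' by move=> M; rewrite /= evK yK.
have act' g v : parabolic k g ->
    x' (dual_act (dual_act (@tangent_act C n k)) g v) =
    ul k_le g *m x' v *m @lr C n k (invmx g).
  move=> pg; rewrite -[v]zK bidual_act; last exact: tangent_act_linear.
  by rewrite /= !evK act.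
split=> [r|].
  exists (fun i : {ffun 'I_k -> 'I_r.+1} =>
    E_sub k_le (@tangent_ur C n k k_le) (fun j => i j)); split.
    move=> i _; split; last exact: (E_sub_highest_weight k_gt0 xK yK act).
    exact: (E_sub_irreducible k_gt0 xK yK act
      (@levi_parabolic C n k k_le) (fun _ => id)).
  exact: (sym_decomposition k_gt0 k_le xK yK).
split; first exact: (sym_multiplicity_free k_gt0 x'K y'K act').
by move=> l d; apply: (sym_fundamental k_gt0 x'K y'K act').
Qed.
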